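(* Let $q$ be a power of a prime $p$ and let $n$ be a positive integer such that $p$ does not divide $n^2-n+1$. Suppose that $q+1\equiv 0\pmod{(n^2-n+1)}$. Then both the Hurwitz curve $\mathcal X_n$ of equation $X^nY+Y^nZ+Z^nX=0$ and the Fermat curve $\mathcal F_{n^2-n+1}$ of equation $U^{n^2-n+1}+V^{n^2-n+1}+W^{n^2-n+1}=0$ are $\mathbf F_{q^2}$-covered by the Hermitian curve $X^{q+1}+Y^{q+1}+Z^{q+1}=0$. In particular, both are $\mathbf F_{q^2}$-maximal.
   Context: An $\mathbf F_{q^2}$-maximal curve of genus $g$ is a projective, geometrically irreducible, non-singular algebraic curve defined over $\mathbf F_{q^2}$ whose number of $\mathbf F_{q^2}$-rational points equals $1+q^2+2qg$. A curve $\mathcal X$ is $\mathbf F_{q^2}$-covered by a curve $\mathcal Y$ if there is a non-constant (surjective) morphism $\mathcal Y\to\mathcal X$ defined over $\mathbf F_{q^2}$. *)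

(* Defs.v *)
From HB Require Import structures.
From mathcomp Require Export all_boot all_order all_algebra all_field.
From mathcomp Require Export mpoly.

Set Implicit Arguments.
Unset Strict Implicit.
Unset Printing Implicit Defensive.

Import GRing.Theory.
Local Open Scope ring_scope.

HB.instance Definition _ (K : finFieldType) (vT : vectType K) :=
  CanIsCountable (@VectorInternalTheory.vs2mxK K vT).
HB.instance Definition _ (K : finFieldType) (vT : vectType K) :=
  isFinite.Build {vspace vT}
    (pcan_enumP (can_pcan (@VectorInternalTheory.vs2mxK K vT))).

(* The projective plane P^2(L): the lines through the origin of L^3. *)
Definition P2 (L : fieldType) := {U : {vspace 'rV[L]_3} | \dim U == 1%N}.

Definition eval_at (L : fieldType) (F : {mpoly L[3]}) (v : 'rV[L]_3) : L :=
  F.@[fun i => v 0 i].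

(* [vpick] returns some nonzero vector of the line P; for homogeneous F, which
   is the only use made of it below, the vanishing of F there does not depend
   on this vector. *)
Definition coords (L : fieldType) (P : P2 L) : 'rV[L]_3 := vpick (val P).

Definition vanishes_at (L : fieldType) (F : {mpoly L[3]}) (P : P2 L) : bool :=
  eval_at F (coords P) == 0.

(* Number of K-rational points of the plane curve F = 0. *)
Definition nb_rational_points (K : finFieldType) (F : {mpoly K[3]}) : nat :=
  #|[pred P : P2 K | vanishes_at F P]|.

(* h is the dimension of the degree m part of the homogeneous coordinate ring
   K[X,Y,Z]/(F); U is the degree m part of the ideal (F). *)
Definition hilbert_function (K : fieldType) (F : {mpoly K[3]}) (m h : nat) :
    Prop :=
  exists U : {vspace dhomog 3 K m},
    (forall G : dhomog 3 K m,
       G \in U <-> exists H : {mpoly K[3]}, (G : {mpoly K[3]}) = H * F) /\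
    h = (\dim {: dhomog 3 K m} - \dim U)%N.

(* The genus of a nonsingular projective curve is its arithmetic genus
   1 - P(0), where P is the Hilbert polynomial. *)
Definition has_genus (K : fieldType) (F : {mpoly K[3]}) (g : nat) : Prop :=
  exists (P : {poly rat}) (m0 : nat),
    (forall m : nat, (m0 <= m)%N ->
       exists2 h : nat, hilbert_function F m h & h%:R = P.[m%:R]) /\
    g%:R = 1 - P.[0].

Definition irreducible_form (L : fieldType) (F : {mpoly L[3]}) : Prop :=
  [/\ F != 0, F \isn't a GRing.unit &
      forall G H : {mpoly L[3]}, F = G * H ->
        G \is a GRing.unit \/ H \is a GRing.unit].

Section OverAlgebraicClosure.

Variables (K : fieldType) (Kbar : closedFieldType).
Variable iota : {rmorphism K -> Kbar}.

Definition base_change (F : {mpoly K[3]}) : {mpoly Kbar[3]} := map_mpoly iota F.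

Definition geometrically_irreducible (F : {mpoly K[3]}) : Prop :=
  irreducible_form (base_change F).

Definition nonsingular (F : {mpoly K[3]}) : Prop :=
  forall P : P2 Kbar, vanishes_at (base_change F) P ->
    exists i : 'I_3, ~~ vanishes_at (base_change F)^`M(i) P.

Definition geometric_points (F : {mpoly K[3]}) : Type :=
  {P : P2 Kbar | vanishes_at (base_change F) P}.

Definition point_of (F : {mpoly K[3]}) (P : geometric_points F) : P2 Kbar :=
  val P.

Definition forms_at (A : 'I_3 -> {mpoly K[3]}) (P : P2 Kbar) : 'rV[Kbar]_3 :=
  \row_i eval_at (base_change (A i)) (coords P).

(* phi is a morphism over K if around every geometric point it is of the form
   P |-> [A_0(P) : A_1(P) : A_2(P)], for forms A_0, A_1, A_2 of the same degree
   with coefficients in K. *)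
Definition is_morphism (F G : {mpoly K[3]})
    (phi : geometric_points F -> geometric_points G) : Prop :=
  forall P : geometric_points F,
    exists (d : nat) (A : 'I_3 -> {mpoly K[3]}),
      [/\ forall i, A i \is d.-homog,
          forms_at A (point_of P) != 0 &
          forall Q : geometric_points F, forms_at A (point_of Q) != 0 ->
            val (point_of (phi Q)) = <[forms_at A (point_of Q)]>%VS].

(* The curve G = 0 is K-covered by the curve F = 0. *)
Definition covered_by (G F : {mpoly K[3]}) : Prop :=
  exists phi : geometric_points F -> geometric_points G,
    [/\ is_morphism phi,
        exists P Q : geometric_points F, phi P <> phi Q &
        forall Q : geometric_points G, exists P : geometric_points F,
          phi P = Q].

End OverAlgebraicClosure.

(* For K with q^2 elements. *)
Definition maximal (q : nat) (K : finFieldType) (Kbar : closedFieldType)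
    (iota : {rmorphism K -> Kbar}) (F : {mpoly K[3]}) : Prop :=
  [/\ exists d : nat, F \is d.-homog,
      geometrically_irreducible iota F,
      nonsingular iota F &
      exists2 g : nat, has_genus F g &
        nb_rational_points F = (1 + q ^ 2 + 2 * q * g)%N].

Section Forms.

Variable K : fieldType.

Local Notation X := ('X_(0 : 'I_3) : {mpoly K[3]}).
Local Notation Y := ('X_(1 : 'I_3) : {mpoly K[3]}).
Local Notation Z := ('X_(2%:R : 'I_3) : {mpoly K[3]}).

Definition fermat (d : nat) : {mpoly K[3]} := X ^+ d + Y ^+ d + Z ^+ d.

Definition hurwitz (n : nat) : {mpoly K[3]} :=
  X ^+ n * Y + Y ^+ n * Z + Z ^+ n * X.

Definition hermitian (q : nat) : {mpoly K[3]} := fermat q.+1.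

End Forms.

(* Main.v *)
(** The map (U : V : W) |-> (U^n W : U V^n : V W^n) sends the Fermat curve of
    degree m = n^2 - n + 1 onto the Hurwitz curve, and since m s = q + 1 raising
    coordinates to the power s sends the Hermitian curve onto the Fermat curve.
    All these triples of forms are defined everywhere on the source curve.

    A reducible nonsingular plane curve would have factors without common zero,
    which is excluded by restricting them to suitable lines.

    Points are counted directly.  Both counts reduce to the equation A + B + 1 = 0
    in K, subject to conditions on the classes of A and B modulo m-th powers.
    As F_q^* consists of m-th powers, these classes depend only on a = A^(q-1) and
    b = B^(q-1); and A is recovered as (b - 1)/(a - b), so that the elements
    A outside F_q correspond to the pairs of distinct (q+1)-th roots of unity
    a, b <> 1. *)
From HB Require Import structures.
Require Import Defs.
From mathcomp Require Import cyclic ring zify.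
Import GRing.Theory Num.Theory.
Local Open Scope ring_scope.

Set Implicit Arguments.
Unset Strict Implicit.
Unset Printing Implicit Defensive.

(** * Irreducibility *)

Lemma dhomog_eval_scale (R : comNzRingType) (n d : nat) (G : {mpoly R[n]})
    (v : 'I_n -> R) (c : R) :
  G \is d.-homog -> G.@[fun i => c * v i] = c ^+ d * G.@[v].
Proof.
move=> /dhomogP hG; rewrite !mevalE big_distrr /= big_seq [RHS]big_seq.
apply: eq_bigr => m /hG <-; rewrite mulrCA; congr (_ * _).
rewrite /= mdegE -prodrXr -big_split /=.
by apply: eq_bigr => i _; rewrite exprMn.
Qed.

(** The restriction of [G] to the line [w + t v], as a polynomial in [t]; the point [v] corresponds
    to [t] at infinity. *)
Definition line_poly (R : comNzRingType) (n : nat) (w v : 'I_n -> R)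
    (G : {mpoly R[n]}) : {poly R} :=
  mmap polyC (fun i => (w i)%:P + (v i)%:P * 'X) G.

Lemma line_polyM (R : comNzRingType) (n : nat) (w v : 'I_n -> R) G H :
  line_poly w v (G * H) = line_poly w v G * line_poly w v H.
Proof. exact: rmorphM. Qed.

Lemma line_poly0 (R : comNzRingType) (n : nat) (w v : 'I_n -> R) G :
  (line_poly w v G)`_0 = G.@[w].
Proof.
rewrite -horner_coef0 /line_poly /mmap horner_sum mevalE.
apply: eq_bigr => m _; rewrite hornerM hornerC /mmap1 horner_prod.
by congr (_ * _); apply: eq_bigr => i _; rewrite !hornerE ?mulr0 ?addr0.
Qed.

(** Here [d] only bounds the degree and [c] may be zero, so that the notion is multiplicative even
    when a form vanishes at infinity. *)
Definition top_coef (R : comNzRingType) (d : nat) (P : {poly R}) (c : R) :=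
  (size P <= d.+1)%N /\ P`_d = c.

Lemma top_coefM (R : comNzRingType) d e (P Q : {poly R}) a b :
  top_coef d P a -> top_coef e Q b -> top_coef (d + e) (P * Q) (a * b).
Proof.
move=> [sP <-] [sQ <-]; split.
  by apply: leq_trans (size_polyMleq P Q) _; lia.
rewrite coefM (bigD1 (inord d)) //= inordK ?ltnS ?leq_addr// addKn.
rewrite big1 ?addr0// => i ne_id.
have /eqP ni : (i : nat) != d.
  apply: contraNneq ne_id => def_i; apply/eqP/val_inj.
  by rewrite /= inordK ?ltnS ?leq_addr.
have /orP[le|le] : (d < i)%N || (e < d + e - i)%N by have := ltn_ord i; lia.
  by rewrite nth_default ?mul0r// (leq_trans sP).
by rewrite [X in _ * X]nth_default ?mulr0// (leq_trans sQ).
Qed.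

(** Each coordinate [w i + v i t] has [t]-coefficient [v i], so a monomial of degree [d] contributes
    its value at [v] to the coefficient of [t^d]. *)
Lemma line_poly_top (R : comNzRingType) (n d : nat) (w v : 'I_n -> R)
    (G : {mpoly R[n]}) :
  G \is d.-homog -> top_coef d (line_poly w v G) G.@[v].
Proof.
move=> /dhomogP hG; rewrite mevalE /line_poly /mmap.
rewrite big_seq [X in top_coef _ _ X]big_seq.
elim/big_rec2: _ => [|m b a /hG dm [sa <-]].
  by split; rewrite ?size_poly0 ?coef0.
have top_lin i : top_coef 1 ((w i)%:P + (v i)%:P * 'X) (v i).
  split; last by rewrite coefD coefC coefMX coefC add0r.
  apply: leq_trans (size_polyD _ _) _; rewrite geq_max.
  rewrite (leq_trans (size_polyC_leq1 _))//=.
  by apply: leq_trans (size_polyMleq _ _) _; rewrite size_polyX; have := size_polyC_leq1 (v i); lia.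
have top_exp i k : top_coef k (((w i)%:P + (v i)%:P * 'X) ^+ k) (v i ^+ k).
  elim: k => [|k ih]; first by split; rewrite ?expr0 ?size_poly1 ?coef1.
  by rewrite !exprS -add1n; exact: top_coefM.
have top_prod : top_coef (mdeg m) (mmap1 (fun i => (w i)%:P + (v i)%:P * 'X) m)
                 (\prod_i v i ^+ m i).
  rewrite mdegE /mmap1; elim/big_rec3: _ => [|i x y z _ h].
    by split; rewrite ?size_poly1 ?coef1.
  exact: top_coefM.
have topC : top_coef 0 (G@_m)%:P G@_m.
  by split; [exact: size_polyC_leq1 | rewrite coefC].
have := top_coefM topC top_prod; rewrite add0n dm => -[s1 <-].
split; last by rewrite coefD.
by apply: leq_trans (size_polyD _ _) _; rewrite geq_max s1.
Qed.

(** The ring morphism sending each variable [X_i] to [X_i T]: it sorts [G] into its homogeneous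
    components, the one of degree [d] being the coefficient of [T^d]. *)
Definition grading (R : comNzRingType) (n : nat) (G : {mpoly R[n]}) :
    {poly {mpoly R[n]}} :=
  mmap (polyC \o @mpolyC n R) (fun i => 'X_i *: 'X) G.

Lemma coef_grading (R : comNzRingType) (n d : nat) (G : {mpoly R[n]}) :
  (grading G)`_d = pihomog mdeg d G.
Proof.
rewrite /grading /mmap coef_sum pihomogE [RHS]big_mkcond /=.
apply: eq_bigr => m _.
have -> : mmap1 (fun i => 'X_i *: 'X) m = 'X_[m] *: 'X^(mdeg m) :> {poly {mpoly R[n]}}.
  rewrite /mmap1 (eq_bigr (fun i => ('X_i ^+ m i) *: 'X^(m i))); last first.
    by move=> i _; rewrite exprZn.
  rewrite scaler_prod prodrXr -mdegE; congr (_ *: _).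
  by rewrite mpolyXE_id.
rewrite coefCM coefZ coefXn eq_sym; case: eqP => _; last by rewrite !mulr0.
by rewrite mulr1 mul_mpolyC.
Qed.

(** Induction on [d]: the product vanishes at 0, so ['X] divides one of the two factors and can be
    cancelled. *)
Lemma monomial_factorl (R : idomainType) (c : R) (d : nat) (P Q : {poly R}) :
  c != 0 -> P * Q = c *: 'X^d -> exists a i, P = a *: 'X^i.
Proof.
move=> c0; elim: d P Q => [|d ih] P Q PQ.
  have PQ0 : P * Q != 0 by rewrite PQ expr0 alg_polyC polyC_eq0.
  have : size (P * Q) = 1%N by rewrite PQ expr0 alg_polyC size_polyC c0.
  move: PQ0; rewrite mulf_eq0 => /norP[P0 Q0].
  rewrite size_mul// => sPQ; have sP : (size P <= 1)%N.
    by move: sPQ; rewrite -!size_poly_gt0 in P0 Q0; lia.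
  by exists P`_0, 0%N; rewrite expr0 alg_polyC; exact: size1_polyC.
have : root (P * Q) 0 by rewrite PQ /root hornerE hornerXn expr0n mulr0.
have X0 : 'X - 0%:P = 'X :> {poly R} by rewrite subr0.
have XI : injective (fun p : {poly R} => p * 'X) by apply: mulIf; rewrite polyX_eq0.
rewrite rootM => /orP[] /factor_theorem[P']; rewrite X0 => def.
  have [|a [i P'E]] := ih P' Q.
    by apply: XI; rewrite /= -scalerAl -exprSr -PQ def mulrAC.
  by exists a, i.+1; rewrite def P'E -scalerAl -exprSr.
by apply: (ih P P'); apply: XI; rewrite /= -scalerAl -exprSr -PQ def mulrA.
Qed.

(** Under [grading] a form becomes a monomial in [T], and over a domain a factor of a nonzero
    monomial is again a monomial. *)
Lemma dhomog_factorl (R : idomainType) (n d : nat) (G H : {mpoly R[n]}) :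
  G * H != 0 -> G * H \is d.-homog -> exists e, G \is e.-homog.
Proof.
move=> GH0 hGH.
have grad : grading (G * H) = (G * H) *: 'X^d.
  apply/polyP => i; rewrite coef_grading coefZ coefXn.
  case: eqP => [->|/eqP ne]; first by rewrite mulr1 pihomog_dE.
  by rewrite mulr0 (pihomog_ne0 _ hGH)// eq_sym.
have gradM : grading (G * H) = grading G * grading H.
  exact: rmorphM.
have [a [i Gi]] := monomial_factorl GH0 (etrans (esym gradM) grad).
exists i; rewrite homog_piE; apply/eqP.
rewrite [RHS](pihomog_partitionE (leqnn (mmeasure mdeg G))).
have gradj j : pihomog mdeg j G = if j == i then a else 0.
  by rewrite -coef_grading Gi coefZ coefXn; case: eqP => _; rewrite ?mulr1 ?mulr0.
rewrite gradj eqxx; under eq_bigr do rewrite gradj.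
(* The decomposition of [G] runs over degrees below [mmeasure mdeg G]; if [i] lies outside this
   range, every component is zero and so is [G]. *)
have [lt|ge] := ltnP i (mmeasure mdeg G).
  by rewrite (bigD1 (Ordinal lt)) //= eqxx big1 ?addr0// => j /negbTE; rewrite -val_eqE /= => ->.
have G0 : G = 0.
  rewrite (pihomog_partitionE (leqnn (mmeasure mdeg G))) big1 // => j _.
  by rewrite gradj ltn_eqF// (leq_trans (ltn_ord j)).
by move: GH0; rewrite G0 mul0r eqxx.
Qed.

Lemma dhomog_factors (R : idomainType) (n d : nat) (G H : {mpoly R[n]}) :
  G * H != 0 -> G * H \is d.-homog ->
  exists e f, [/\ G \is e.-homog, H \is f.-homog & d = (e + f)%N].
Proof.
move=> GH0 hGH; have [e hG] := dhomog_factorl GH0 hGH.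
have [f hH] : exists f, H \is f.-homog.
  by apply: (@dhomog_factorl _ _ d H G); rewrite mulrC.
exists e, f; split => //; apply: (dhomog_uniq GH0 hGH); exact: dhomogM.
Qed.

Lemma dhomog0_unit (L : fieldType) (n : nat) (G : {mpoly L[n]}) :
  G != 0 -> G \is 0.-homog -> G \is a GRing.unit.
Proof.
move=> G0 /dhomogP hG.
have sG : (msize G <= 1)%N.
  by rewrite msizeE big_seq; elim/big_ind: _ => // [x y|m /hG ->//]; rewrite geq_max => -> ->.
move: G0; rewrite (msize1_polyC sG) mpolyC_eq0 => c0.
by apply: (rmorph_unit (@mpolyC n L)); rewrite unitfE.
Qed.

(** A form of positive degree vanishes at the origin, where a unit cannot. *)
Lemma dhomog_pos_nonunit (L : fieldType) (n d : nat) (F : {mpoly L[n]}) :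
  (0 < d)%N -> F \is d.-homog -> F \isn't a GRing.unit.
Proof.
move=> d0 hF; apply/negP => uF.
have := rmorph_unit (meval (fun=> 0 : L)) uF; rewrite unitfE => /eqP; apply.
have := dhomog_eval_scale (fun=> 0) 0 hF; by rewrite expr0n gtn_eqF// [RHS]mul0r mul0r.
Qed.

Definition nonsingular_form (L : fieldType) (F : {mpoly L[3]}) : Prop :=
  forall v : 'I_3 -> L, (exists i, v i != 0) -> F.@[v] = 0 ->
    exists i, F^`M(i).@[v] != 0.

(** By the product rule, all derivatives of [G * H] vanish at a common zero of [G] and [H]. *)
Lemma no_common_zero (L : fieldType) (G H : {mpoly L[3]}) (v : 'I_3 -> L) :
  nonsingular_form (G * H) -> (exists i, v i != 0) ->
  G.@[v] = 0 -> H.@[v] = 0 -> False.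
Proof.
move=> ns v0 Gv Hv; have [|i] := ns v v0; first by rewrite mevalM Gv mul0r.
by rewrite mderivM mevalD !mevalM Gv Hv mulr0 mul0r addr0 eqxx.
Qed.

(** The factors of a form are forms, and those of degree 0 are units, so only factorizations into
    forms of positive degree have to be excluded. *)
Lemma irreducible_form_homog (L : fieldType) (d : nat) (F : {mpoly L[3]}) :
  (0 < d)%N -> F != 0 -> F \is d.-homog ->
  (forall (G H : {mpoly L[3]}) e f, F = G * H ->
     G \is e.+1.-homog -> H \is f.+1.-homog -> False) ->
  irreducible_form F.
Proof.
move=> d0 F0 hF nofact; split=> // [|G H FGH]; first exact: dhomog_pos_nonunit hF.
have GH0 : G * H != 0 by rewrite -FGH.
have [e [f [hG hH _]]] : exists e f, [/\ G \is e.-homog, H \is f.-homog & d = (e + f)%N].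
  by apply: dhomog_factors; rewrite -?FGH.
move: GH0; rewrite mulf_eq0 => /norP[G0 H0].
case: e hG => [|e] hG; first by left; exact: dhomog0_unit.
case: f hH => [|f] hH; first by right; exact: dhomog0_unit.
by have := nofact G H e f FGH hG hH.
Qed.

(* On a line where the form restricts to a constant, each factor of positive
   degree vanishes at infinity. *)
Lemma line_const_factor (L : fieldType) (w v : 'I_3 -> L) (G H : {mpoly L[3]}) e f :
  line_poly w v (G * H) = 1 -> G \is e.+1.-homog -> H \is f.+1.-homog ->
  G.@[v] = 0 /\ H.@[v] = 0.
Proof.
rewrite line_polyM => GH1 hG hH.
have sG : size (line_poly w v G) = 1%N.
  by apply/eqP; rewrite -dvdp1; apply/dvdpP; exists (line_poly w v H); rewrite mulrC.
have sH : size (line_poly w v H) = 1%N.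
  by apply/eqP; rewrite -dvdp1; apply/dvdpP; exists (line_poly w v G).
have [_ <-] := line_poly_top w v hG; have [_ <-] := line_poly_top w v hH.
by rewrite !nth_default ?sG ?sH.
Qed.

(** As ['X] is prime, one factor is a nonzero constant on the line. That factor is nonzero at [w]
    but, having positive degree, vanishes at [v]; the other one must vanish at [w], and cannot
    vanish at [v] by nonsingularity. *)
Lemma line_X_factor (L : fieldType) (w v : 'I_3 -> L) (G H : {mpoly L[3]}) e f :
  nonsingular_form (G * H) -> (exists i, v i != 0) ->
  line_poly w v (G * H) = 'X -> G \is e.+1.-homog -> H \is f.+1.-homog ->
  [/\ G.@[w] = 0, G.@[v] != 0, H.@[w] != 0 & H.@[v] = 0] \/
  [/\ G.@[w] != 0, G.@[v] = 0, H.@[w] = 0 & H.@[v] != 0].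
Proof.
move=> ns v0 lX hG hH.
(* The degrees of the two restrictions add up to 1 and the conclusion is symmetric in [G] and [H],
   so [G] may be taken to be the constant one. *)
wlog sG : G H e f ns lX hG hH / size (line_poly w v G) = 1%N.
  move=> wl; have GHX := lX; rewrite line_polyM in GHX.
  have GH0 : line_poly w v G * line_poly w v H != 0 by rewrite GHX polyX_eq0.
  move: (GH0); rewrite mulf_eq0 => /norP[G0 H0].
  have := congr1 (fun p : {poly L} => size p) GHX; rewrite size_mul// size_polyX => sGH.
  rewrite -!size_poly_gt0 in G0 H0.
  have /orP[/eqP sG|/eqP sH] : (size (line_poly w v G) == 1%N) || (size (line_poly w v H) == 1%N).
    by move: G0 H0 sGH; case: (size _) => [|[|a]]//; case: (size _) => [|[|b]]//=; lia.
  - exact: (wl G H e f).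
  - rewrite mulrC in ns lX.
    by have [[? ? ? ?]|[? ? ? ?]] := wl H G f e ns lX hH hG sH; [right|left].
right.
have Gv : G.@[v] = 0.
  by have [_ <-] := line_poly_top w v hG; rewrite nth_default ?sG.
have Gw : G.@[w] != 0.
  have : lead_coef (line_poly w v G) != 0 by rewrite lead_coef_eq0 -size_poly_gt0 sG.
  by rewrite lead_coefE sG line_poly0.
have Hv : H.@[v] != 0.
  by apply/eqP => Hv; exact: no_common_zero ns v0 Gv Hv.
have := congr1 (fun p : {poly L} => p`_0) lX.
rewrite line_poly0 mevalM coefX => /eqP; rewrite mulf_eq0 (negbTE Gw) => /eqP Hw.
by split.
Qed.

(** * Values, derivatives and nonsingularity of the Fermat and Hurwitz forms *)

Section PlaneForms.
Variable L : fieldType.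

Lemma fermat_eval d (v : 'I_3 -> L) :
  (fermat L d).@[v] = v 0 ^+ d + v 1 ^+ d + v 2%:R ^+ d.
Proof. by rewrite /fermat !(mevalD, rmorphXn) /= !mevalXU. Qed.

Lemma hurwitz_eval n (v : 'I_3 -> L) :
  (hurwitz L n).@[v] = v 0 ^+ n * v 1 + v 1 ^+ n * v 2%:R + v 2%:R ^+ n * v 0.
Proof. by rewrite /hurwitz !(mevalD, mevalM, rmorphXn) /= !mevalXU. Qed.

Lemma mpolyX_homog (i : 'I_3) : ('X_i : {mpoly L[3]}) \is 1.-homog.
Proof. by rewrite dhomogX /= mdeg1. Qed.

Lemma mpolyXn_homog (i : 'I_3) k : ('X_i ^+ k : {mpoly L[3]}) \is k.-homog.
Proof. by rewrite -[X in X.-homog]mul1n; exact/dhomogMn/mpolyX_homog. Qed.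

Lemma fermat_homog d : fermat L d \is d.-homog.
Proof. by rewrite /fermat; do 2?apply: dhomogD; exact: mpolyXn_homog. Qed.

Lemma hurwitz_homog n : hurwitz L n \is n.+1.-homog.
Proof.
rewrite /hurwitz -[n.+1]addn1.
by do 2?apply: dhomogD; apply: dhomogM; (exact: mpolyX_homog || exact: mpolyXn_homog).
Qed.

Lemma mderivXU (i j : 'I_3) : ('X_i : {mpoly L[3]})^`M(j) = (i == j)%:R.
Proof.
rewrite mderivX mnm1E; case: eqP => [->|_]; last by rewrite scale0r.
by rewrite -mpolyX0 scale1r; congr 'X_[_]; apply/mnmP => k; rewrite mnmBE subnn mnm0E.
Qed.

Lemma mderivXn (P : {mpoly L[3]}) k j : (P ^+ k)^`M(j) = k%:R * P ^+ k.-1 * P^`M(j).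
Proof.
elim: k => [|k ih]; first by rewrite expr0 -mpolyC1 mderivC !mul0r.
rewrite exprS mderivM ih /=; case: k {ih} => [|k] /=; first by rewrite expr0; ring.
by rewrite exprS -[k.+2%:R]natr1; ring.
Qed.

Lemma fermat_deriv d (v : 'I_3 -> L) i :
  ((fermat L d)^`M(i)).@[v] = d%:R * v i ^+ d.-1.
Proof.
rewrite /fermat !mderivD !mderivXn !mderivXU !mevalD !mevalM !rmorphXn /= !mevalXU.
rewrite !rmorph_nat.
case: i => -[|[|[|//]]] lt /=; rewrite ?mulr1 ?mulr0 ?addr0 ?add0r; congr (_ * _ ^+ _);
  by congr v; apply: val_inj.
Qed.

Lemma hurwitz_deriv n (v : 'I_3 -> L) (x := v 0) (y := v 1) (z := v 2%:R) :
  [/\ ((hurwitz L n)^`M(0)).@[v] = n%:R * x ^+ n.-1 * y + z ^+ n,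
      ((hurwitz L n)^`M(1)).@[v] = n%:R * y ^+ n.-1 * z + x ^+ n &
      ((hurwitz L n)^`M(2%:R)).@[v] = n%:R * z ^+ n.-1 * x + y ^+ n].
Proof.
rewrite /x /y /z /hurwitz.
by split; rewrite !mderivD !mderivM !mderivXn !mderivXU !(mevalD, mevalM) !rmorphXn /=
  !mevalXU !rmorph_nat /=; ring.
Qed.

Lemma fermat_nonsingular d : d%:R != 0 :> L -> nonsingular_form (fermat L d).
Proof.
move=> d0 v [i vi] _; exists i.
by rewrite fermat_deriv mulf_neq0// expf_neq0.
Qed.

(* With a = x^n y, b = y^n z, c = z^n x, a singular point satisfies
   c = - n a and b = n^2 a, whence (n^2 - n + 1) a = a + b + c = 0. *)
Lemma hurwitz_nonsingular n : (0 < n)%N -> (n ^ 2 - n + 1)%:R != 0 :> L ->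
  nonsingular_form (hurwitz L n).
Proof.
move=> n0 m0 v [i vi]; rewrite hurwitz_eval.
have [] := hurwitz_deriv n v; set x := v 0; set y := v 1; set z := v 2%:R.
move=> d0 d1 d2 F0.
have [/eqP e0|] := eqVneq ((hurwitz L n)^`M(0)).@[v] 0; last by exists 0.
have [/eqP e1|] := eqVneq ((hurwitz L n)^`M(1)).@[v] 0; last by exists 1.
have [/eqP e2|] := eqVneq ((hurwitz L n)^`M(2%:R)).@[v] 0; last by exists 2%:R.
rewrite {}d0 in e0; rewrite {}d1 in e1; rewrite {}d2 in e2.
move/eqP in e0; move/eqP in e1; move/eqP in e2.
have mE : (n ^ 2 - n + 1)%:R = n%:R ^+ 2 - n%:R + 1 :> L.
  by rewrite natrD natrB ?natrX// expnS leq_pmulr// expn_gt0 n0.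
have pX t : t ^+ n = t ^+ n.-1 * t :> L by rewrite -exprSr prednK.
have E0 : n%:R * (x ^+ n * y) + z ^+ n * x = 0.
  by rewrite -[RHS](mul0r x) -e0 (pX x); ring.
have E1 : n%:R * (y ^+ n * z) + x ^+ n * y = 0.
  by rewrite -[RHS](mul0r y) -e1 (pX y); ring.
have E2 : n%:R * (z ^+ n * x) + y ^+ n * z = 0.
  by rewrite -[RHS](mul0r z) -e2 (pX z); ring.
move: E0 E1 E2 F0; set a := x ^+ n * y; set b := y ^+ n * z; set c := z ^+ n * x.
move=> E0 E1 E2 F0.
have a0 : a = 0.
  apply/eqP; suff : (n ^ 2 - n + 1)%:R * a == 0 by rewrite mulf_eq0 (negbTE m0).
  apply/eqP; rewrite mE; transitivity (a + b + c - (n%:R * c + b) + (n%:R - 1) * (n%:R * a + c)).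
    by ring.
  by rewrite F0 E0 E2; ring.
have c0 : c = 0 by move: E0; rewrite a0 mulr0 add0r.
have b0 : b = 0 by move: E2; rewrite c0 mulr0 add0r.
(* The vanishing of [a], [b], [c] kills at least two coordinates, and then one of the derivatives
   reduces to the [n]-th power of the third. *)
have xyz : [&& x == 0, y == 0 & z == 0].
  have tn (t : L) : t ^+ n = 0 -> t == 0 by move=> /eqP; rewrite expf_eq0 => /andP[].
  move/eqP: a0; move/eqP: b0; move/eqP: c0.
  rewrite /a /b /c !mulf_eq0 !expf_eq0 n0 /= => c0 b0 a0.
  have [x0|x0] := boolP (x == 0).
    have [y0|y0] := boolP (y == 0).
      by apply: tn; rewrite -e0 (eqP y0); ring.
    move: a0 b0 c0; rewrite (negbTE y0) /= => _ z0 _; exfalso; move/negP: y0; apply.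
    by apply: tn; rewrite -e2 (eqP x0); ring.
  move: a0 c0; rewrite (negbTE x0) /= orbF => y0 z0; exfalso; move/negP: x0; apply.
  by apply: tn; rewrite -e1 (eqP z0); ring.
exfalso; move: xyz vi => /and3P[/eqP x0 /eqP y0 /eqP z0] /eqP; apply.
by case: i => -[|[|[|//]]] lt; [rewrite -x0|rewrite -y0|rewrite -z0]; congr v; apply: val_inj.
Qed.

End PlaneForms.

Lemma exp_root (L : closedFieldType) n (a : L) : (0 < n)%N -> exists b, b ^+ n = a.
Proof.
move=> n0; have [c def_c] := @solve_monicpoly L n (fun i => if i == 0%N then a else 0) n0.
exists c; rewrite def_c (bigD1 (Ordinal n0)) //= expr0 mulr1 big1 ?addr0//.
by move=> i; rewrite -val_eqE /= => /negbTE ->; rewrite mul0r.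
Qed.

(* The line joining (0, 0, 1) to (c, 1, 0), where c^d = -1, meets the curve only at
   the latter point. *)
Lemma fermat_irreducible (L : closedFieldType) d :
  (0 < d)%N -> d%:R != 0 :> L -> irreducible_form (fermat L d).
Proof.
move=> d_gt0 d0.
have F0 : fermat L d != 0.
  apply/eqP => F0; have := fermat_eval d (fun i : 'I_3 => if i == 0 then 1 else 0 : L).
  by rewrite F0 meval0 /= expr1n !expr0n gtn_eqF// !addr0 => /eqP; rewrite eq_sym oner_eq0.
apply: (irreducible_form_homog d_gt0 F0 (fermat_homog L d)) => G H e f FGH hG hH.
have [c cd] := exp_root (-1 : L) d_gt0.
pose w (i : 'I_3) : L := if i == 2%:R then 1 else 0.
pose v (i : 'I_3) : L := if i == 0 then c else if i == 1 then 1 else 0.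
have line1 : line_poly w v (fermat L d) = 1.
  rewrite /line_poly /fermat !rmorphD !rmorphXn /= !mmapX !mmap1U /w /v /=.
  rewrite !add0r mul0r addr0 mul1r expr1n exprMn -rmorphXn /= cd polyCN mulN1r addNr add0r.
  by [].
have [Gv Hv] : G.@[v] = 0 /\ H.@[v] = 0.
  by apply: (@line_const_factor _ w v _ _ e f _ hG hH); rewrite -FGH.
have ns := fermat_nonsingular d0; rewrite FGH in ns.
by apply: no_common_zero ns _ Gv Hv; exists 1; exact: oner_neq0.
Qed.

(* The form restricts to the parameter t on each of the three lines P_2 + t P_0,
   P_0 + t P_1, P_1 + t P_2; the pattern of vanishing of two factors at the
   coordinate points given by [line_X_factor] is inconsistent around this cycle. *)
Lemma hurwitz_irreducible (L : fieldType) n :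
  (0 < n)%N -> (n ^ 2 - n + 1)%:R != 0 :> L -> irreducible_form (hurwitz L n).
Proof.
move=> n0 m0; pose P (j i : 'I_3) : L := if i == j then 1 else 0.
have lX : [/\ line_poly (P 2%:R) (P 0) (hurwitz L n) = 'X,
              line_poly (P 0) (P 1) (hurwitz L n) = 'X &
              line_poly (P 1) (P 2%:R) (hurwitz L n) = 'X].
  by split; rewrite /line_poly /hurwitz !rmorphD !rmorphM !rmorphXn /= !mmapX !mmap1U /P /=;
    rewrite ?polyC0 ?polyC1 ?(mul0r, mul1r, add0r, addr0) ?expr1n ?expr0n ?gtn_eqF//;
    rewrite ?(mul0r, mul1r, mulr0, add0r, addr0).
have F0 : hurwitz L n != 0.
  apply/eqP => F0; case: lX => + _ _; rewrite F0 /line_poly rmorph0 => /eqP.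
  by rewrite eq_sym polyX_eq0.
apply: (irreducible_form_homog (ltn0Sn n) F0 (hurwitz_homog L n)) => G H e f FGH hG hH.
have ns := hurwitz_nonsingular n0 m0; rewrite FGH in ns lX.
have P0 j : exists i, P j i != 0 by exists j; rewrite /P eqxx oner_neq0.
case: lX => /(line_X_factor ns (P0 _))/(_ hG hH) l1.
move=> /(line_X_factor ns (P0 _))/(_ hG hH) l2.
move=> /(line_X_factor ns (P0 _))/(_ hG hH) l3.
case: l1 => [[? /eqP ? /eqP ? ?]|[/eqP ? ? ? /eqP ?]];
  case: l2 => [[? /eqP ? /eqP ? ?]|[/eqP ? ? ? /eqP ?]];
  by case: l3 => [[? /eqP ? /eqP ? ?]|[/eqP ? ? ? /eqP ?]].
Qed.

(** * The genus of a plane curve *)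

Lemma dim_dhomog (K : fieldType) m : \dim {: dhomog 3 K m} = 'C(m + 2, 2).
Proof. by rewrite dimvf /= /dim /= -bin_sub ?leq_addr// addKn. Qed.

Lemma pihomogM (R : comNzRingType) (n d e : nat) (F H : {mpoly R[n]}) :
  F \is d.-homog -> pihomog mdeg (e + d) (H * F) = pihomog mdeg e H * F.
Proof.
move=> hF; rewrite [in LHS](pihomog_partitionE (leqnn (mmeasure mdeg H))).
rewrite mulr_suml raddf_sum /=.
rewrite (eq_bigr (fun i : 'I__ => if (i : nat) == e then pihomog mdeg e H * F else 0)); last first.
  move=> i _; have hi := dhomogM (pihomogP mdeg i H) hF.
  case: eqP => [<-|/eqP ne]; first by rewrite pihomog_dE.
  by rewrite (pihomog_ne0 _ hi)// eqn_add2r.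
have [lt|ge] := ltnP e (mmeasure mdeg H).
  rewrite (bigD1 (Ordinal lt)) //= eqxx big1 ?addr0// => j /negbTE.
  by rewrite -val_eqE /= => ->.
have -> : pihomog mdeg e H = 0.
  rewrite pihomogE big_seq_cond big1// => m /andP[mH /eqP dm].
  by have := mmeasure_mnm_lt mdeg mH; rewrite dm ltnNge ge.
by rewrite mul0r big1// => i _; case: ifP.
Qed.

(** Multiplication by [F] is a linear injection of the forms of degree [m - d] onto the degree [m]
    part of the ideal. *)
Lemma hilbert_function_homog (K : fieldType) (F : {mpoly K[3]}) (d m : nat) :
  F \is d.-homog -> F != 0 -> (d <= m)%N ->
  hilbert_function F m ('C(m + 2, 2) - 'C(m - d + 2, 2)).
Proof.
move=> hF F0 dm.
have hM (G : dhomog 3 K (m - d)) : (G : {mpoly K[3]}) * F \is m.-homog.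
  by have := dhomogM (dhomog_is_dhomog G) hF; rewrite (subnK dm).
pose f G : dhomog 3 K m := DHomog (hM G).
have f_lin : linear f by move=> c G H; apply: val_inj; rewrite /= mulrDl scalerAl.
pose fL : {linear dhomog 3 K (m - d) -> dhomog 3 K m} :=
  HB.pack f (GRing.isLinear.Build _ _ _ _ f f_lin).
exists (limg (linfun fL)); split.
  move=> G; split.
    by move=> /memv_imgP[H _ ->]; exists (H : {mpoly K[3]}); rewrite lfunE.
  move=> [H defG].
  (* The cofactor [H] is an arbitrary polynomial; only its component of degree [m - d] contributes
     to [G]. *)
  have <- : fL (DHomog (pihomogP mdeg (m - d) H)) = G.
    apply: val_inj; rewrite /= -(pihomogM _ _ hF) subnK// -defG pihomog_dE//.
    exact: dhomog_is_dhomog.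
  by rewrite -lfunE memv_img// memvf.
rewrite dim_dhomog limg_dim_eq ?dim_dhomog//.
apply/eqP; rewrite -subv0; apply/subvP => G; rewrite memv_cap => /andP[_].
rewrite memv_ker lfunE memv0 => /eqP/(congr1 val)/eqP; rewrite /= mulf_eq0 (negbTE F0) orbF.
by move=> /eqP G0; apply/eqP/val_inj.
Qed.

Lemma natr_bin2 (R : numFieldType) k : ('C(k + 2, 2))%:R = (k%:R + 1) * (k%:R + 2) / 2 :> R.
Proof.
have /(congr1 (fun i => i%:R : R)) := mul_bin_diag (k + 2) 1.
rewrite bin1 !natrM addn2 /= => e2.
have h : 2%:R != 0 :> R by rewrite pnatr_eq0.
by apply: (mulfI h); rewrite -e2 -natr1 -natr1; field.
Qed.

Lemma has_genus_plane (K : fieldType) (F : {mpoly K[3]}) (d : nat) :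
  (0 < d)%N -> F \is d.-homog -> F != 0 -> has_genus F 'C(d.-1, 2).
Proof.
move=> d0 hF F0.
(* [Q c] is the binomial coefficient of ['X - c + 2] over 2 as a polynomial, so [Q 0 - Q d] is the
   Hilbert polynomial. *)
pose Q (c : rat) : {poly rat} := 2^-1 *: (('X - c%:P + 1%:P) * ('X - c%:P + 2%:R%:P)).
have QE c x : (Q c).[x] = 2^-1 * ((x - c + 1) * (x - c + 2)).
  by rewrite hornerZ hornerM !hornerD hornerN hornerX !hornerC.
exists (Q 0 - Q d%:R), d; split.
  move=> m dm; exists ('C(m + 2, 2) - 'C(m - d + 2, 2))%N.
    exact: hilbert_function_homog.
  rewrite natrB; last by rewrite leq_bin2l// leq_add2r leq_subr.
  by rewrite !natr_bin2 natrB// hornerD hornerN !QE; field.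
rewrite hornerD hornerN !QE.
(* Lines and conics are treated apart: for them the binomial coefficient is 0 and not of the shape
   required by [natr_bin2]. *)
case: d d0 {hF} => // -[|d] _ /=; first by rewrite bin_small//; field.
case: d => [|d]; first by rewrite bin_small//; field.
by rewrite -[d.+2]addn2 natr_bin2 -addn1 !natrD; field.
Qed.

(** * Coverings *)

Section Points.
Variable L : fieldType.
Implicit Types (P : P2 L) (v w : 'rV[L]_3) (F : {mpoly L[3]}).

Lemma coords_neq0 P : coords P != 0.
Proof. by rewrite vpick0 -dimv_eq0 (eqP (valP P)). Qed.

Lemma coords_line P : <[coords P]>%VS = val P.
Proof.
apply/eqP; rewrite eqEdim dim_vline coords_neq0 (eqP (valP P)) leqnn andbT.
by rewrite -memvE memv_pick.
Qed.

Lemma dim_vline_neq0 v : v != 0 -> \dim <[v]>%VS == 1%N.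
Proof. by rewrite dim_vline => ->. Qed.

Lemma eq_vline v w : v != 0 -> v \in <[w]>%VS -> <[v]>%VS = <[w]>%VS.
Proof.
move=> v0 vw; apply/eqP; rewrite eqEdim -memvE vw !dim_vline v0 /=.
by case: (w != 0).
Qed.

Definition point v (v0 : v != 0) : P2 L := exist _ <[v]>%VS (dim_vline_neq0 v0).

Lemma eval_atZ d F c v : F \is d.-homog -> eval_at F (c *: v) = c ^+ d * eval_at F v.
Proof.
by move=> hF; rewrite -(dhomog_eval_scale _ _ hF); apply: meval_eq => i; rewrite mxE.
Qed.

Lemma vanishes_at_vec d F P v :
  F \is d.-homog -> v != 0 -> v \in val P -> vanishes_at F P = (eval_at F v == 0).
Proof.
move=> hF v0; rewrite -coords_line => /vlineP[c def_v].
have c0 : c != 0 by apply: contraNneq v0 => c0; rewrite def_v c0 scale0r.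
by rewrite def_v (eval_atZ _ _ hF) mulf_eq0 expf_eq0 (negbTE c0) andbF.
Qed.

Lemma vanishes_at_point d F v (v0 : v != 0) :
  F \is d.-homog -> vanishes_at F (point v0) = (eval_at F v == 0).
Proof. by move=> hF; apply: (vanishes_at_vec hF v0); exact: memv_line. Qed.

Lemma rV3_neq0 v : v != 0 -> exists i, v 0 i != 0.
Proof.
move=> v0; apply/existsP; apply: contraNT v0; rewrite negb_exists => /forallP v0.
by apply/eqP/rowP => i; rewrite mxE; apply/eqP; move: (v0 i); rewrite negbK.
Qed.

End Points.

Section Cover.
Variables (K : fieldType) (Kbar : closedFieldType) (iota : {rmorphism K -> Kbar}).

Lemma base_change_homog d (F : {mpoly K[3]}) :
  F \is d.-homog -> base_change iota F \is d.-homog.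
Proof.
move=> /dhomogP hF; apply/dhomogP => m.
by rewrite (perm_mem (msupp_map_mpoly _ (fmorph_inj iota))) => /hF.
Qed.

Lemma base_change_fermat d : base_change iota (fermat K d) = fermat Kbar d.
Proof. by rewrite /base_change /fermat !rmorphD !rmorphXn /= !map_mpolyX. Qed.

Lemma base_change_hurwitz n : base_change iota (hurwitz K n) = hurwitz Kbar n.
Proof. by rewrite /base_change /hurwitz !rmorphD !rmorphM !rmorphXn /= !map_mpolyX. Qed.

Lemma nonsingular_base_change (F : {mpoly K[3]}) :
  nonsingular_form (base_change iota F) -> nonsingular iota F.
Proof.
move=> ns P /eqP FP; have [|i di] := ns _ _ FP; last by exists i.
exact: rV3_neq0 (coords_neq0 P).
Qed.

Definition form_map (A : 'I_3 -> {mpoly K[3]}) (v : 'rV[Kbar]_3) : 'rV[Kbar]_3 :=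
  \row_i eval_at (base_change iota (A i)) v.

Lemma form_mapZ k A c v :
  (forall i, A i \is k.-homog) -> form_map A (c *: v) = c ^+ k *: form_map A v.
Proof.
move=> hA; apply/rowP => i; rewrite !mxE.
by rewrite (eval_atZ _ _ (base_change_homog (hA i))).
Qed.

(** The triple [A] has no base point on [F], so it defines the morphism around every point. Two
    distinct points [w1], [w2] of the target, together with surjectivity, show that it is not
    constant. *)
Lemma covered_by_forms (F G : {mpoly K[3]}) (d e k : nat) (A : 'I_3 -> {mpoly K[3]}) :
  F \is d.-homog -> G \is e.-homog -> (forall i, A i \is k.-homog) ->
  (forall v, v != 0 -> eval_at (base_change iota F) v = 0 ->
     form_map A v != 0 /\ eval_at (base_change iota G) (form_map A v) = 0) ->
  (forall w, w != 0 -> eval_at (base_change iota G) w = 0 ->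
     exists v, [/\ v != 0, eval_at (base_change iota F) v = 0 &
                   w \in <[form_map A v]>%VS]) ->
  (exists w1 w2, [/\ w2 != 0, w1 \notin <[w2]>%VS,
     eval_at (base_change iota G) w1 = 0 & eval_at (base_change iota G) w2 = 0]) ->
  covered_by iota G F.
Proof.
move=> /base_change_homog hF /base_change_homog hG hA FG GF [w1 [w2 [w20 w12 Gw1 Gw2]]].
have nz (P : geometric_points iota F) : form_map A (coords (val P)) != 0.
  by case: (FG _ (coords_neq0 (val P)) (eqP (valP P))).
have van (P : geometric_points iota F) : vanishes_at (base_change iota G) (point (nz P)).
  rewrite (vanishes_at_point _ hG).
  by case: (FG _ (coords_neq0 (val P)) (eqP (valP P))) => _ ->.
pose phi (P : geometric_points iota F) : geometric_points iota G :=
  exist _ (point (nz P)) (van P).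
have phi_onto Q : exists P, phi P = Q.
  have [v [v0 Fv Qv]] := GF _ (coords_neq0 (val Q)) (eqP (valP Q)).
  have vanv : vanishes_at (base_change iota F) (point v0).
    by rewrite (vanishes_at_point _ hF) Fv.
  exists (exist _ (point v0) vanv); do 2!apply: val_inj => /=.
  rewrite -[RHS]coords_line.
  (* The vector picked on the line of [v] is only a multiple [c *: v]; homogeneity of [A] turns this
     into a factor [c ^+ k]. *)
  have /vlineP[c defv] : coords (point v0) \in <[v]>%VS by exact: memv_pick.
  have c0 : c != 0.
    by apply: contraNneq (coords_neq0 (point v0)) => c0; rewrite defv c0 scale0r.
  rewrite (eq_vline (coords_neq0 (val Q)) Qv) defv (form_mapZ _ _ hA).
  apply: eq_vline; last by apply: memvZ; exact: memv_line.
  rewrite scaler_eq0 negb_or expf_neq0//=.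
  by case: (FG _ v0 Fv).
exists phi; split=> //.
  by move=> P; exists k, A; split=> //; exact: nz P.
have w10 : w1 != 0 by apply: contraNneq w12 => ->; exact: mem0v.
have v1 : vanishes_at (base_change iota G) (point w10).
  by rewrite (vanishes_at_point _ hG) Gw1.
have v2 : vanishes_at (base_change iota G) (point w20).
  by rewrite (vanishes_at_point _ hG) Gw2.
have [P1 phi1] := phi_onto (exist _ (point w10) v1).
have [P2 phi2] := phi_onto (exist _ (point w20) v2).
exists P1, P2; rewrite phi1 phi2 => /(congr1 (fun Q => val (val Q))) /= eq12.
by move: w12; rewrite -eq12 memv_line.
Qed.

(** * The power map and the monomial map from the Fermat curve to the Hurwitz curve *)

Definition vec3 (R : nzRingType) (a b c : R) : 'rV[R]_3 :=
  \row_i (if i == 0 then a else if i == 1 then b else c).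

Lemma vec3E (R : nzRingType) (v : 'rV[R]_3) : v = vec3 (v 0 0) (v 0 1) (v 0 2%:R).
Proof.
by apply/rowP => -[[|[|[|//]]] lt]; rewrite mxE /=; congr (v _ _); apply: val_inj.
Qed.

Lemma vec3_eq0 (R : nzRingType) (a b c : R) :
  (vec3 a b c == 0) = [&& a == 0, b == 0 & c == 0].
Proof.
apply/eqP/and3P => [v0|[/eqP -> /eqP -> /eqP ->]].
  by split; apply/eqP; [have /rowP/(_ 0) := v0|have /rowP/(_ 1) := v0|have /rowP/(_ 2%:R) := v0];
    rewrite !mxE.
by apply/rowP => i; rewrite !mxE; case: ifP => //; case: ifP.
Qed.

Lemma fermat_vec (L : fieldType) d (a b c : L) :
  eval_at (fermat L d) (vec3 a b c) = a ^+ d + b ^+ d + c ^+ d.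
Proof. by rewrite /eval_at fermat_eval !mxE. Qed.

Lemma hurwitz_vec (L : fieldType) n (a b c : L) :
  eval_at (hurwitz L n) (vec3 a b c) = a ^+ n * b + b ^+ n * c + c ^+ n * a.
Proof. by rewrite /eval_at hurwitz_eval !mxE. Qed.

Definition forms3 (f g h : {mpoly K[3]}) (i : 'I_3) :=
  if i == 0 then f else if i == 1 then g else h.

Lemma form_map_powers s (a b c : Kbar) :
  form_map (fun i => 'X_i ^+ s) (vec3 a b c) = vec3 (a ^+ s) (b ^+ s) (c ^+ s).
Proof.
apply/rowP => i; rewrite !mxE /eval_at /base_change rmorphXn /= map_mpolyX rmorphXn /=.
by rewrite mevalXU mxE; case: ifP => //; case: ifP.
Qed.

(** The composite of raising the coordinates to the power [s] with (u : v : w) |-> (u^n w : u v^n :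
    v w^n). *)
Definition hurwitz_cover n s : 'I_3 -> {mpoly K[3]} :=
  forms3 ('X_0 ^+ (n * s) * 'X_(2%:R) ^+ s) ('X_0 ^+ s * 'X_1 ^+ (n * s))
         ('X_1 ^+ s * 'X_(2%:R) ^+ (n * s)).

Lemma form_map_hurwitz_cover n s (a b c : Kbar) :
  form_map (hurwitz_cover n s) (vec3 a b c) =
  vec3 ((a ^+ s) ^+ n * c ^+ s) (a ^+ s * (b ^+ s) ^+ n) (b ^+ s * (c ^+ s) ^+ n).
Proof.
apply/rowP => -[[|[|[|//]]] lt]; rewrite !mxE /eval_at /base_change /hurwitz_cover /forms3 /=
  rmorphM !rmorphXn /= !map_mpolyX mevalM !rmorphXn /= !mevalXU !mxE /=;
  by rewrite mulnC !exprM.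
Qed.

Lemma hurwitz_cover_homog n s i : hurwitz_cover n s i \is (n * s + s).-homog.
Proof.
rewrite /hurwitz_cover /forms3; case: ifP => _; last case: ifP => _.
- by apply: dhomogM; exact: mpolyXn_homog.
- by rewrite addnC; apply: dhomogM; exact: mpolyXn_homog.
- by rewrite addnC; apply: dhomogM; exact: mpolyXn_homog.
Qed.

(** With m = n^2 - n + 1 one has n^2 + 1 = m + n, so each term on the left is (u v w)^n times the
    m-th power of one variable. *)
Lemma hurwitz_of_fermat (R : comNzRingType) n (u v w : R) : (0 < n)%N ->
  (u ^+ n * w) ^+ n * (u * v ^+ n) + (u * v ^+ n) ^+ n * (v * w ^+ n)
    + (v * w ^+ n) ^+ n * (u ^+ n * w) =
  (u * v * w) ^+ n *
    (u ^+ (n ^ 2 - n + 1) + v ^+ (n ^ 2 - n + 1) + w ^+ (n ^ 2 - n + 1)).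
Proof.
move=> n0.
have pE (t : R) : t ^+ (n ^ 2 - n + 1) * t ^+ n = t ^+ n ^+ n * t.
  by rewrite -exprD -exprM -exprSr; congr (_ ^+ _); nia.
rewrite !exprMn !mulrDr.
transitivity ((u ^+ n ^+ n * u) * v ^+ n * w ^+ n
   + u ^+ n * (v ^+ n ^+ n * v) * w ^+ n + u ^+ n * v ^+ n * (w ^+ n ^+ n * w)).
  by ring.
by rewrite -!pE; ring.
Qed.

(** If all three monomials vanished, at least two of [u], [v], [w] would be zero, and the Fermat
    equation would kill the third. *)
Lemma fermat_to_hurwitz_neq0 (L : fieldType) n (u v w : L) :
  let m := (n ^ 2 - n + 1)%N in
  ~~ [&& u == 0, v == 0 & w == 0] -> u ^+ m + v ^+ m + w ^+ m = 0 ->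
  ~~ [&& u ^+ n * w == 0, u * v ^+ n == 0 & v * w ^+ n == 0].
Proof.
move=> m nz; apply: contra_eqN; rewrite !mulf_eq0 !expf_eq0 /m addn1.
move: nz; have [->|u0] := eqVneq u 0; have [->|v0] := eqVneq v 0;
  have [->|w0] := eqVneq w 0; rewrite ?andbF ?orbF ?andbT //= => _;
  rewrite ?expr0n /= ?addr0 ?add0r ?expf_neq0 //.
Qed.

Lemma fermat_to_hurwitz_onto (L : closedFieldType) n (x y z : L) :
  (0 < n)%N ->
  let m := (n ^ 2 - n + 1)%N in
  ~~ [&& x == 0, y == 0 & z == 0] -> x ^+ n * y + y ^+ n * z + z ^+ n * x = 0 ->
  exists u v w c : L,
    [/\ ~~ [&& u == 0, v == 0 & w == 0], u ^+ m + v ^+ m + w ^+ m = 0 &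
        [/\ x = c * (u ^+ n * w), y = c * (u * v ^+ n) & z = c * (v * w ^+ n)]].
Proof.
move=> n0 m nz F0; have m0 : (0 < m)%N by rewrite /m addn1.
(* The coordinate points of the Hurwitz curve are the images of (0 : 1 : e), (1 : e : 0) and (1 : 0
   : e). *)
have [e em] := exp_root (-1 : L) m0.
have e0 : e != 0.
  apply/eqP => e0; move/eqP: em; rewrite e0 expr0n gtn_eqF// eq_sym oppr_eq0.
  by rewrite oner_eq0.
have en0 k : e ^+ k != 0 by rewrite expf_neq0.
have [x0|x0] := eqVneq x 0.
  move: nz F0; rewrite x0 eqxx expr0n gtn_eqF// mul0r mulr0 addr0 add0r /= => nz.
  move/eqP; rewrite mulf_eq0 expf_eq0 n0 /= => /orP[/eqP y0|/eqP z0].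
    exists 0, 1, e, (z / e ^+ n); rewrite eqxx oner_eq0 expr1n em !expr0n !gtn_eqF//.
    split=> //; first by rewrite add0r subrr.
    by split; rewrite ?y0 ?(expr1n, mul0r, mulr0, mul1r)// divfK.
  exists 1, e, 0, (y / e ^+ n); rewrite eqxx oner_eq0 expr1n em !expr0n !gtn_eqF//.
  split=> //; first by rewrite addr0 subrr.
  by split; rewrite ?z0 ?(expr1n, mul0r, mulr0, mul1r)// divfK.
have [y0|y0] := eqVneq y 0.
  move: F0; rewrite y0 expr0n gtn_eqF// mul0r mulr0 !add0r => /eqP.
  rewrite mulf_eq0 (negbTE x0) orbF expf_eq0 n0 /= => /eqP z0.
  exists 1, 0, e, (x / e); rewrite eqxx oner_eq0 expr1n em !expr0n !gtn_eqF//.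
  split=> //; first by rewrite addr0 subrr.
  by split; rewrite ?z0 ?(expr1n, mul0r, mulr0, mul1r)// divfK.
have z0 : z != 0.
  apply/eqP => z0; move/eqP: F0; rewrite z0 mulr0 expr0n gtn_eqF// mul0r !addr0.
  by rewrite mulf_eq0 expf_eq0 (negbTE x0) (negbTE y0) andbF.
(* Off the coordinate lines take w = 1. The ratio of [x] to [z] forces v = u^n z / x and c = x /
   u^n; substituting these in y = c u v^n leaves this equation for u^m. *)
have [u um] := exp_root (y * x ^+ n.-1 / z ^+ n) m0.
have u0 : u != 0.
  apply/eqP => u0; move/eqP: um; rewrite u0 expr0n gtn_eqF// eq_sym !mulf_eq0.
  by rewrite invr_eq0 !expf_eq0 (negbTE x0) (negbTE y0) (negbTE z0) !andbF.
pose v := u ^+ n * z / x; pose c := x / u ^+ n.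
have un0 : u ^+ n != 0 by rewrite expf_neq0.
have v0 : v != 0 by rewrite !mulf_neq0 ?invr_eq0.
have c0 : c != 0 by rewrite mulf_neq0 ?invr_eq0.
have xE : x = c * (u ^+ n * 1) by rewrite mulr1 divfK.
have zE : z = c * (v * 1 ^+ n) by rewrite expr1n /c /v; field; apply/andP.
have yE : y = c * (u * v ^+ n).
  have -> : u * v ^+ n = u ^+ m * u ^+ n * z ^+ n / x ^+ n.
    have -> : u ^+ m * u ^+ n = u * u ^+ n ^+ n.
      by rewrite -exprM -exprS -exprD; congr (_ ^+ _); rewrite /m; nia.
    by rewrite /v expr_div_n exprMn !mulrA.
  have xn : x ^+ n = x * x ^+ n.-1 by rewrite -exprS prednK.
  have ? : x ^+ n.-1 != 0 by rewrite expf_neq0.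
  have ? : z ^+ n != 0 by rewrite expf_neq0.
  by rewrite um /c xn; field; apply/and4P.
clearbody c v.
exists u, v, 1, c; split=> //; first by rewrite oner_eq0 !andbF.
(* The Fermat equation for (u : v : 1) follows from the Hurwitz equation by cancelling the nonzero
   factor c^(n+1) (u v)^n. *)
have := hurwitz_of_fermat u v 1 n0; rewrite -/m => E.
have scale (k r t o : L) : (k * r) ^+ n * (k * t) + (k * t) ^+ n * (k * o) + (k * o) ^+ n * (k * r)
    = k ^+ n.+1 * (r ^+ n * t + t ^+ n * o + o ^+ n * r).
  by rewrite !exprMn exprS; ring.
have : c ^+ n.+1 * ((u * v * 1) ^+ n * (u ^+ m + v ^+ m + 1 ^+ m)) = 0.
  by rewrite -E -scale -xE -yE -zE.
by move/eqP; rewrite !mulf_eq0 !expf_eq0 !mulf_eq0 (negbTE c0) (negbTE u0) (negbTE v0)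
  oner_eq0 !andbF /= => /eqP.
Qed.

Lemma fermat_covered m s : (0 < m)%N -> (0 < s)%N ->
  covered_by iota (fermat K m) (fermat K (m * s)).
Proof.
move=> m0 s0.
apply: (@covered_by_forms _ _ (m * s) m s (fun i => 'X_i ^+ s));
  rewrite ?base_change_fermat.
- exact: fermat_homog.
- exact: fermat_homog.
- by move=> i; exact: mpolyXn_homog.
- move=> v; rewrite [v]vec3E form_map_powers !fermat_vec !vec3_eq0 !expf_eq0 s0 /=.
  by split=> //; rewrite -!exprM mulnC.
- move=> w; rewrite [w]vec3E vec3_eq0 fermat_vec => nz Fw.
  have [a aE] := exp_root (w 0 0) s0.
  have [b bE] := exp_root (w 0 1) s0.
  have [c cE] := exp_root (w 0 2%:R) s0.
  move: nz Fw; rewrite -aE -bE -cE => nz Fw.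
  exists (vec3 a b c); rewrite form_map_powers memv_line fermat_vec vec3_eq0.
  by move: nz Fw; rewrite !expf_eq0 s0 /= -!exprM mulnC.
- have [e em] := exp_root (-1 : Kbar) m0.
  exists (vec3 0 1 e), (vec3 1 0 e).
  rewrite !fermat_vec vec3_eq0 oner_eq0 em expr1n expr0n gtn_eqF// add0r addr0 subrr.
  split=> //; apply/negP => /vlineP[k] /rowP E.
  by move: (E 1); rewrite !mxE /= mulr0 => /eqP; rewrite oner_eq0.
Qed.

Lemma hurwitz_covered n s : (0 < n)%N -> (0 < s)%N ->
  covered_by iota (hurwitz K n) (fermat K ((n ^ 2 - n + 1) * s)).
Proof.
set m := (n ^ 2 - n + 1)%N => n0 s0.
apply: (@covered_by_forms _ _ (m * s) n.+1 (n * s + s) (hurwitz_cover n s));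
  rewrite ?base_change_fermat ?base_change_hurwitz.
- exact: fermat_homog.
- exact: hurwitz_homog.
- exact: hurwitz_cover_homog.
- move=> v; rewrite [v]vec3E form_map_hurwitz_cover fermat_vec hurwitz_vec !vec3_eq0.
  rewrite [(m * s)%N]mulnC !exprM => nz Fv.
  split; first by apply: fermat_to_hurwitz_neq0 => //; rewrite !expf_eq0 s0.
  by rewrite hurwitz_of_fermat// Fv mulr0.
- move=> w; rewrite [w]vec3E vec3_eq0 hurwitz_vec => nz Fw.
  have [u [v [t [c [nz' F' [xE yE zE]]]]]] := fermat_to_hurwitz_onto n0 nz Fw.
  have [a aE] := exp_root u s0.
  have [b bE] := exp_root v s0.
  have [d dE] := exp_root t s0.
  exists (vec3 a b d); rewrite vec3_eq0 fermat_vec form_map_hurwitz_cover aE bE dE.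
  split.
  + by move: nz'; rewrite -aE -bE -dE !expf_eq0 s0.
  + by rewrite [(m * s)%N]mulnC !exprM aE bE dE.
  + apply/vlineP; exists c; apply/rowP => i; rewrite !mxE xE yE zE.
    by case: ifP => //; case: ifP.
- exists (vec3 1 0 0), (vec3 0 1 0).
  rewrite !hurwitz_vec vec3_eq0 oner_eq0 eqxx !expr0n !gtn_eqF// !(mul0r, mulr0, addr0).
  split=> //; apply/negP => /vlineP[k] /rowP/(_ 0).
  by rewrite !mxE /= mulr0 => /eqP; rewrite oner_eq0.
Qed.

End Cover.

(** * Counting points *)

Section PowerFibers.
Variable K : finFieldType.
Local Notation N := (#|K|.-1).

Lemma card_pred_gt0 : (0 < N)%N.
Proof. by rewrite -ltnS prednK; [exact: finNzRing_gt1|exact: ltnW (finNzRing_gt1 K)]. Qed.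

Lemma expf_card_pred (x : K) : x != 0 -> x ^+ N = 1.
Proof.
move=> x0; apply: (mulfI x0); rewrite mulr1 -exprS prednK ?expf_card//.
exact: ltnW (finNzRing_gt1 K).
Qed.

Lemma finField_prim_root : exists w : K, N.-primitive_root w.
Proof.
have /hasP[w _ prim_w] : has N.-primitive_root [seq x <- enum K | x != 0].
  apply: has_prim_root.
  - exact: card_pred_gt0.
  - apply/allP => x; rewrite mem_filter => /andP[x0 _].
    by apply/unity_rootP; exact: expf_card_pred.
  - by rewrite filter_uniq ?enum_uniq.
  rewrite -(cardC1 (0 : K)) cardE enumT /enum_mem !size_filter.
  by rewrite (@eq_count _ _ (fun x => x != 0)).
by exists w.
Qed.

Lemma card_unity_roots k : (k %| N)%N -> #|[pred x : K | x ^+ k == 1]| = k.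
Proof.
move=> kN; have [w prim_w] := finField_prim_root.
have prim_z := dvdn_prim_root prim_w kN; set z := w ^+ _ in prim_z.
rewrite -[RHS]card_ord -(@card_image _ _ (fun i : 'I_k => z ^+ i)).
  apply: eq_card => x; rewrite inE; apply/eqP/imageP => [/(prim_rootP prim_z)[i ->]|[i _ ->]].
    by exists i.
  by rewrite exprAC (prim_expr_order prim_z) expr1n.
move=> i j /eqP; rewrite (eq_prim_root_expr prim_z) !modn_small// => /eqP.
exact: val_inj.
Qed.

(** The multiplicative group is cyclic of order [N], so its [k]-th powers are the solutions of
    a^(N/k) = 1; each nonempty fiber is a coset of the [k]-th roots of unity. *)
Lemma card_power_fiber k (a : K) : (k %| N)%N -> a != 0 ->
  #|[pred x : K | x ^+ k == a]| = (k * (a ^+ (N %/ k) == 1)%R)%N.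
Proof.
move=> kN a0; have [eqa|nea] := eqVneq (a ^+ (N %/ k)) 1; last first.
  rewrite muln0; apply: eq_card0 => x; rewrite inE; apply: contra_neqF nea => /eqP xa.
  rewrite -xa -exprM mulnC divnK// expf_card_pred//.
  apply: contraNneq a0 => x0.
  by rewrite -xa x0 expr0n gtn_eqF// (dvdn_gt0 card_pred_gt0 kN).
have [w prim_w] := finField_prim_root.
have [j aw] := prim_rootP prim_w (expf_card_pred a0).
have kj : (k %| j)%N.
  move/eqP: eqa; rewrite aw -exprM -(prim_order_dvd prim_w).
  rewrite -{1}(divnK kN) mulnC dvdn_pmul2r// divn_gt0 ?(dvdn_gt0 card_pred_gt0)//.
  exact: dvdn_leq card_pred_gt0 kN.
pose b := w ^+ (j %/ k); have ba : b ^+ k = a by rewrite -exprM divnK.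
have b0 : b != 0.
  by apply: contraNneq a0 => b0; rewrite -ba b0 expr0n gtn_eqF// (dvdn_gt0 card_pred_gt0 kN).
rewrite muln1 -[RHS](card_unity_roots kN) -(card_image (mulIf b0) [pred y : K | y ^+ k == 1]).
apply: eq_card => x; rewrite inE; apply/eqP/imageP => [xa|[y + ->]].
  exists (x / b); last by rewrite divfK.
  by rewrite inE expr_div_n xa ba divff.
by rewrite inE exprMn ba => /eqP ->; rewrite mul1r.
Qed.
End PowerFibers.

Lemma sum_delta (I : finType) (P : pred I) (h : I -> nat) c : P c ->
  (\sum_(i | P i) h i * (i == c) = h c)%N.
Proof.
move=> Pc; rewrite (bigD1 c)//= eqxx muln1 big1 ?addn0// => i /andP[_ /negbTE ->].
by rewrite muln0.
Qed.

(** * Phases on the unit circle and sums over A + B + 1 = 0 *)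

Section UnitCircle.
Variables (K : finFieldType) (p e q : nat).
Hypotheses (p_prime : prime p) (e_gt0 : (0 < e)%N) (q_def : q = (p ^ e)%N).
Hypothesis card_K : #|K| = (q ^ 2)%N.

Lemma q_gt1 : (1 < q)%N.
Proof. by rewrite q_def (leq_ltn_trans _ (ltn_expl e (prime_gt1 p_prime))). Qed.

Lemma card_pred_factor : #|K|.-1 = (q.-1 * q.+1)%N.
Proof. by rewrite card_K; have := q_gt1; case: q => // n _; rewrite /=; nia. Qed.

Lemma pchar_K : p \in [pchar K].
Proof. by apply: (@card_finPcharP K p (e * 2)) => //; rewrite card_K q_def -expnM. Qed.

Lemma expqD (x y : K) : (x + y) ^+ q = x ^+ q + y ^+ q.
Proof. by apply: exprDn_pchar; rewrite q_def pnatX (pnatE _ p_prime) pchar_K. Qed.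

Lemma expqN (x : K) : (- x) ^+ q = - x ^+ q.
Proof.
apply/eqP; rewrite -subr_eq0 opprK -expqD addNr expr0n gtn_eqF//.
exact: ltnW q_gt1.
Qed.

Definition unit_circle : pred K := [pred x | x ^+ q.+1 == 1].

Definition circle_pair (u : K * K) :=
  [&& unit_circle u.1, unit_circle u.2, u.1 != 1, u.2 != 1 & u.1 != u.2].

(* The class of x in K^* / F_q^*, as an element of the unit circle. *)
Definition phase (x : K) := x ^+ q.-1.

Lemma phaseE x : phase x * x = x ^+ q.
Proof. by rewrite -exprSr prednK// ltnW// q_gt1. Qed.

Lemma phase_circle x : x != 0 -> unit_circle (phase x).
Proof.
by move=> x0; rewrite /unit_circle /= -exprM -card_pred_factor expf_card_pred.
Qed.

Lemma circle_inv a : unit_circle a -> a != 0 /\ a ^+ q = a^-1.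
Proof.
rewrite /unit_circle /= exprS => /eqP a1; have a0 : a != 0.
  by apply/eqP => a0; move/eqP: a1; rewrite a0 mul0r eq_sym oner_eq0.
by split=> //; apply: (mulfI a0); rewrite a1 divff.
Qed.

(** For B = -1 - A with phases a and b, raising A + B = -1 to the power q gives a A + b B = -1. This
    linear system has the unique solution A = (b - 1)/(a - b), which makes A |-> (a, b) a bijection
    from the complement of F_q. *)
Lemma circle_pair_sum (Q : K -> K -> nat) :
  (\sum_(A : K | (A ^+ q != A)%R) Q (phase A) (phase (-1 - A)%R) =
   \sum_(u | circle_pair u) Q u.1 u.2)%N.
Proof.
have m1q : (-1 : K) ^+ q = -1 by rewrite expqN expr1n.
pose f (A : K) := (phase A, phase (-1 - A)).
pose g (u : K * K) := (u.2 - 1) / (u.1 - u.2).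
have gK u : circle_pair u -> f (g u) = u.
  case: u => a b /and5P[/= /circle_inv[a0 aq] /circle_inv[b0 bq] a1 b1 ab].
  have ab0 : a - b != 0 by rewrite subr_eq0.
  have ba0 : b - a != 0 by rewrite subr_eq0 eq_sym.
  have a10 : a - 1 != 0 by rewrite subr_eq0.
  have b10 : b - 1 != 0 by rewrite subr_eq0.
  rewrite /f /g /=; set A := _ / _.
  have A0 : A != 0 by rewrite mulf_neq0 ?invr_eq0.
  have BE : -1 - A = (1 - a) / (a - b) by rewrite /A; field.
  have B0 : -1 - A != 0 by rewrite BE mulf_neq0 ?invr_eq0// subr_eq0 eq_sym.
  have Aq : A ^+ q = a * A.
    (* On the unit circle the [q]-th power is inversion, which leaves a rational identity in [a] and
       [b]. *)
    rewrite /A expr_div_n !expqD !expqN expr1n aq bq; field.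
    by rewrite mulN1r ba0 ab0 b0 a0.
  congr (_, _); first by apply: (mulIf A0); rewrite phaseE.
  apply: (mulIf B0); rewrite phaseE expqD m1q expqN Aq BE /A; field.
  exact: ab0.
rewrite [RHS](reindex_onto f g)//; apply: eq_bigl => A.
have factor (x : K) : x ^+ q != x -> x != 0 /\ phase x != 1.
  move=> xq; split; apply: contraNneq xq => h; first by rewrite h expr0n gtn_eqF// ltnW// q_gt1.
  by rewrite -phaseE h mul1r.
apply/idP/andP => [Aq|[/and5P[/= /circle_inv[f0 _] _ + _ _] _]]; last first.
  apply: contraNneq => Aq; apply/eqP; have A0 : A != 0.
    apply: contraNneq f0 => ->; rewrite /phase expr0n gtn_eqF//.
    by have := q_gt1; lia.
  by apply: (mulIf A0); rewrite phaseE Aq mul1r.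
have [A0 a1] := factor _ Aq.
have Bq : (-1 - A) ^+ q != -1 - A by rewrite expqD m1q expqN (inj_eq (addrI _)) eqr_opp.
have [B0 b1] := factor _ Bq.
have sumq : phase A * A + phase (-1 - A) * (-1 - A) = -1.
  by rewrite !phaseE -expqD addrCA subrr addr0 m1q.
(* Equal phases a would give a (A + B) = -1, hence a = 1. *)
have ab : phase A != phase (-1 - A).
  apply: contraNneq a1 => ab; apply/eqP; move: sumq; rewrite -ab -mulrDr addrCA subrr addr0.
  by rewrite mulrN1 => /oppr_inj.
split; first by rewrite /circle_pair /= !phase_circle// a1 b1 ab.
apply/eqP; rewrite /g /=; have ab0 : phase A - phase (-1 - A) != 0 by rewrite subr_eq0.
apply: (mulIf ab0); rewrite divfK//.
move: sumq; set a := phase A; set b := phase _ => sumq.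
have -> : b - 1 = b + (a * A + b * (-1 - A)) by rewrite sumq.
ring.
Qed.
Local Notation U := unit_circle.
Let q1 : (1 < q)%N := q_gt1.

Lemma circle1 : U 1.
Proof. by rewrite /unit_circle /= expr1n. Qed.

(** The excluded lines a = 1, b = 1 and a = b meet only at (1, 1), which their three sums count
    three times; this explains the correction by 2. The subtracted terms are moved to the left to
    stay in the naturals. *)
Lemma circle_inclusion_exclusion (Q : K -> K -> nat) :
  (\sum_(u | circle_pair u) Q u.1 u.2 +
     (\sum_(b | U b) Q 1%R b + \sum_(a | U a) Q a 1%R + \sum_(a | U a) Q a a) =
   \sum_(a | U a) \sum_(b | U b) Q a b + 2 * Q 1%R 1%R)%N.
Proof.
have -> : (\sum_(b | U b) Q 1%R b = \sum_(a | U a) \sum_(b | U b) Q a b * (a == 1%R))%N.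
  rewrite -(sum_delta (fun a => \sum_(b | U b) Q a b)%N circle1).
  by apply: eq_bigr => a _; rewrite big_distrl.
have -> : (\sum_(a | U a) Q a 1%R = \sum_(a | U a) \sum_(b | U b) Q a b * (b == 1%R))%N.
  by apply: eq_bigr => a _; rewrite sum_delta//; exact: circle1.
have -> : (\sum_(a | U a) Q a a = \sum_(a | U a) \sum_(b | U b) Q a b * (b == a))%N.
  by apply: eq_bigr => a Ua; rewrite sum_delta.
have -> : (2 * Q 1%R 1%R = \sum_(a | U a) \sum_(b | U b) 2 * Q a b * (a == 1%R) * (b == 1%R))%N.
  under eq_bigr => a _ do rewrite (sum_delta (fun b => 2 * Q a b * (a == 1%R))%N circle1).
  by rewrite (sum_delta (fun a => 2 * Q a 1%R)%N circle1).
rewrite !pair_big /= -!big_split /=.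
have -> : (\sum_(u | circle_pair u) Q u.1 u.2 =
   \sum_(u | U u.1 && U u.2) Q u.1 u.2 * [&& u.1 != 1, u.2 != 1 & u.1 != u.2]%R)%N.
  rewrite [LHS]big_mkcond [RHS]big_mkcond; apply: eq_bigr => u _.
  rewrite /circle_pair; case: (U u.1) => //=; case: (U u.2) => //=.
  by case: (_ && _); rewrite ?muln0 ?muln1.
rewrite -big_split /=; apply: eq_bigr => -[a b] _ /=; rewrite [b == a]eq_sym.
have [->|a1] := eqVneq a 1; have [->|b1] := eqVneq b 1; rewrite ?eqxx /=.
- lia.
- lia.
- lia.
- by case: (a == b) => /=; lia.
Qed.

Lemma card_circle : #|[pred x | U x]| = q.+1.
Proof. by apply: card_unity_roots; rewrite card_pred_factor dvdn_mull. Qed.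

Lemma card_fixed : #|[pred A : K | A ^+ q == A]| = q.
Proof.
rewrite (cardD1 0) inE expr0n gtn_eqF ?(ltnW q1)// eqxx -[RHS](prednK (ltnW q1)) add1n.
congr _.+1.
rewrite -[RHS](@card_unity_roots K q.-1); last first.
  by rewrite card_pred_factor dvdn_mulr.
apply: eq_card => A; rewrite !inE.
have [->|A0] /= := eqVneq A 0.
  by rewrite expr0n gtn_eqF 1?eq_sym ?oner_eq0//; lia.
by rewrite -[RHS](inj_eq (mulfI A0)) mulr1 -exprS (prednK (ltnW q1)).
Qed.

(** The q - 2 elements of F_q other than 0 and -1 have both phases equal to 1; added to the
    correction 2 of the inclusion-exclusion they give the coefficient q of [Q 1 1]. *)
Lemma phase_sum (Q : K -> K -> nat) :
  (\sum_(A : K | ((A != 0) && (A != -1))%R) Q (phase A) (phase (-1 - A)%R) +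
     (\sum_(b | U b) Q 1%R b + \sum_(a | U a) Q a 1%R + \sum_(a | U a) Q a a) =
   \sum_(a | U a) \sum_(b | U b) Q a b + q * Q 1%R 1%R)%N.
Proof.
have m1q : (-1 : K) ^+ q = -1.
  by rewrite expqN expr1n.
rewrite (bigID (fun A : K => A ^+ q == A)) /=.
rewrite [X in (X + _ + _)%N](_ : _ = (q - 2) * Q 1%R 1%R)%N; last first.
  rewrite (eq_bigr (fun=> Q 1%R 1%R)); last first.
    move=> A /andP[/andP[A0 A1] /eqP Aq].
    have fix1 B : B != 0 -> B ^+ q = B -> phase B = 1.
      move=> B0 Bq; apply: (mulIf B0).
      by rewrite phaseE Bq mul1r.
    rewrite !fix1//; first by rewrite subr_eq0 eq_sym.
    by rewrite expqD m1q expqN Aq.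
  rewrite sum_nat_const; congr (_ * _)%N.
  have := card_fixed; rewrite (cardD1 0) (cardD1 (-1)) !inE expr0n gtn_eqF ?(ltnW q1)//.
  rewrite m1q !eqxx oppr_eq0 oner_eq0 /= !add1n => /(congr1 (fun k => k - 2)%N).
  rewrite !subSS subn0 => <-; apply: eq_card => A; rewrite !inE -topredE /=.
  by case: (A == 0); case: (A == -1).
rewrite [X in (_ + X + _)%N](_ : _ = \sum_(u | circle_pair u) Q u.1 u.2)%N; last first.
  rewrite -circle_pair_sum; apply: eq_bigl => A.
  case: eqVneq => [->|_] /=; first by rewrite expr0n gtn_eqF ?(ltnW q1)// eqxx.
  by case: eqVneq => [->|_] //=; rewrite m1q eqxx.
have := circle_inclusion_exclusion Q.
set S := \sum_(u | _) _; set T := (_ + _ + _)%N; set V := \sum_(a | _) \sum_(b | _) _.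
move=> E; rewrite -addnA E.
rewrite addnCA -mulnDl subnK//.
Qed.

End UnitCircle.

(** * Representatives of the rational points of the projective plane *)

Section NormalizedPoints.
Variable K : finFieldType.

(** The last nonzero coordinate is scaled to 1, which cuts the plane into an affine plane, an affine
    line and a point. *)
Definition normalized_vec (t : K * K + (K + unit)) : 'rV[K]_3 :=
  match t with
  | inl (a, b) => vec3 a b 1
  | inr (inl a) => vec3 a 1 0
  | inr (inr _) => vec3 1 0 0
  end.

Lemma normalized_vec_neq0 t : normalized_vec t != 0.
Proof. by case: t => [[a b]|[a|[]]]; rewrite vec3_eq0 oner_eq0 ?andbF. Qed.

Definition normalized_point t : P2 K := point (normalized_vec_neq0 t).

Lemma normalized_point_inj : injective normalized_point.
Proof.
move=> t t' /(congr1 val) /= eqt.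
have /vlineP[k] : normalized_vec t \in <[normalized_vec t']>%VS.
  by rewrite -eqt memv_line.
move/rowP => E; move: (E 0) (E 1) (E 2%:R) (normalized_vec_neq0 t) => {E eqt}.
case: t => [[a b]|[a|[]]]; case: t' => [[a' b']|[a'|[]]]; rewrite !mxE /= ?mulr1 ?mulr0.
- by move=> Ea Eb k1 _; rewrite Ea Eb -k1 !mul1r.
- by move=> _ _ /eqP; rewrite oner_eq0.
- by move=> _ _ /eqP; rewrite oner_eq0.
- by move=> _ E1 k0; move/eqP: E1; rewrite -k0 mul0r oner_eq0.
- by move=> Ea k1 _ _; rewrite Ea -k1 mul1r.
- by move=> _ /eqP; rewrite oner_eq0.
- by move=> E1 _ k0; move/eqP: E1; rewrite -k0 mul0r oner_eq0.
- by move=> E1 k0; move/eqP: E1; rewrite -k0 mul0r oner_eq0.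
- by [].
Qed.

Lemma normalized_point_onto P : exists t, normalized_point t = P.
Proof.
suff [t [k Pk]] : exists t k, coords P = k *: normalized_vec t.
  exists t; apply: val_inj; rewrite /= -coords_line; apply/esym/eq_vline; first exact: coords_neq0.
  by rewrite Pk memvZ// memv_line.
have := coords_neq0 P; rewrite [coords P]vec3E; set a := coords P 0 0.
set b := coords P 0 1; set c := coords P 0 2%:R; rewrite vec3_eq0.
have scale k x y z : k *: vec3 x y z = vec3 (k * x) (k * y) (k * z) :> 'rV[K]_3.
  by apply/rowP => i; rewrite !mxE; case: ifP => //; case: ifP.
have [->|c0] := eqVneq c 0; last first.
  by move=> _; exists (inl (a / c, b / c)), c; rewrite /= scale mulr1 ![c * _]mulrC !divfK.
have [->|b0] := eqVneq b 0; last first.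
  by move=> _; exists (inr (inl (a / b))), b; rewrite /= scale mulr1 mulr0 mulrC divfK.
by move=> _; exists (inr (inr tt)), a; rewrite /= scale mulr1 mulr0.
Qed.

Lemma nb_rational_points_affine (F : {mpoly K[3]}) d : F \is d.-homog ->
  nb_rational_points F =
  (\sum_x \sum_y (eval_at F (vec3 x y 1%R) == 0)%R +
   (\sum_x (eval_at F (vec3 x 1 0) == 0)%R + (eval_at F (vec3 1 0 0) == 0)%R))%N.
Proof.
move=> hF; rewrite /nb_rational_points.
have -> : #|[pred P | vanishes_at F P]| =
  #|[pred t | eval_at F (normalized_vec t) == 0]|.
  rewrite -(card_image normalized_point_inj); apply: eq_card => P; rewrite inE.
  have [t <-] := normalized_point_onto P.
  by rewrite (mem_image normalized_point_inj) inE (vanishes_at_point _ hF).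
rewrite -sum1_card big_mkcond big_sumType big_sumType /=.
congr (_ + (_ + _))%N.
- rewrite pair_bigA /=; apply: eq_bigr => -[a b] _ /=.
  by rewrite inE /=; case: ifP.
- by rewrite (big_pred1 tt) => [|[]//]; rewrite inE /=; case: ifP.
Qed.

End NormalizedPoints.

Lemma sum_pred_card (T : finType) (P : pred T) : (\sum_x (P x : nat) = #|[pred x | P x]|)%N.
Proof. by rewrite -sum1_card [RHS]big_mkcond; apply: eq_bigr => x _; rewrite inE; case: (P x). Qed.

Lemma sum_over_fibers (T T' : finType) (f : T -> T') (h : T' -> nat) :
  (\sum_x h (f x) = \sum_y #|[pred x | f x == y]| * h y)%N.
Proof.
rewrite (partition_big f predT)//=; apply: eq_bigr => y _.
rewrite (eq_bigr (fun=> h y)) => [|x /eqP ->//]; rewrite sum_nat_const; congr (_ * _)%N.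
Qed.

(** * Rational points of the Fermat and Hurwitz curves *)

Section Counting.
Variables (K : finFieldType) (p e q m s : nat).
Hypotheses (p_prime : prime p) (e_gt0 : (0 < e)%N) (q_def : q = (p ^ e)%N).
Hypothesis card_K : #|K| = (q ^ 2)%N.
Hypothesis ms : (m * s)%N = q.+1.
Local Notation U := (@unit_circle K q).
Local Notation phase := (@phase K q).
Let q1 : (1 < q)%N := q_gt1 p_prime e_gt0 q_def.
Let N_factor := card_pred_factor p_prime e_gt0 q_def card_K.

Lemma m_gt0 : (0 < m)%N.
Proof. by move: ms; case: m. Qed.

Lemma s_gt0 : (0 < s)%N.
Proof. by move: ms; case: s => //; rewrite muln0. Qed.

(** As q^2 - 1 = (q - 1) m s, the criterion for [a] to be an [m]-th power is a^((q-1) s) = 1, a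
    condition on the phase alone. *)
Lemma card_mth_roots (a : K) : a != 0 ->
  #|[pred x : K | x ^+ m == a]| = (m * (phase a ^+ s == 1)%R)%N.
Proof.
move=> a0; have mN : (m %| #|K|.-1)%N by rewrite N_factor dvdn_mull// -ms dvdn_mulr.
rewrite (card_power_fiber mN a0) -exprM; congr (_ * (_ ^+ _ == _))%N.
by rewrite N_factor -ms mulnCA mulKn// m_gt0.
Qed.

Lemma card_mth_roots0 : #|[pred x : K | x ^+ m == 0]| = 1%N.
Proof.
by rewrite -(card1 (0 : K)); apply: eq_card => x; rewrite !inE expf_eq0 m_gt0.
Qed.

Lemma phaseN1 : phase (-1) = 1.
Proof.
have h : (-1 : K) != 0 by rewrite oppr_eq0 oner_eq0.
apply: (mulIf h); rewrite (phaseE p_prime e_gt0 q_def) mul1r.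
by rewrite (expqN p_prime e_gt0 q_def card_K) expr1n.
Qed.

Lemma card_mth_rootsN1 : #|[pred x : K | x ^+ m == -1]| = m.
Proof. by rewrite card_mth_roots ?oppr_eq0 ?oner_eq0// phaseN1 expr1n eqxx muln1. Qed.

(** The solutions of b^s = a^s form a coset of the [s]-th roots of unity, and all lie on the unit
    circle since m s = q + 1. *)
Lemma card_circle_fiber (a : K) : a != 0 -> a ^+ s ^+ m = 1 ->
  (\sum_(b | U b) (b ^+ s == a ^+ s)%R = s)%N.
Proof.
move=> a0 am; have sN : (s %| #|K|.-1)%N by rewrite N_factor dvdn_mull// -ms dvdn_mull.
rewrite -[RHS](card_unity_roots sN) -(card_image (mulIf a0) [pred y : K | y ^+ s == 1]).
rewrite -sum1_card big_mkcond [RHS]big_mkcond; apply: eq_bigr => b _.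
have -> : (b \in [seq x * a | x in [pred y : K | y ^+ s == 1]]) = (b ^+ s == a ^+ s).
  apply/imageP/eqP => [[x + ->]|ba].
    by rewrite inE exprMn => /eqP ->; rewrite mul1r.
  by exists (b / a); rewrite ?divfK// inE expr_div_n ba divff// expf_neq0.
case: (eqVneq (b ^+ s)) => [ba|_]; last by case: ifP.
by rewrite /unit_circle /= -ms mulnC exprM ba am eqxx.
Qed.

Lemma card_circle_roots : (\sum_(b | U b) (b ^+ s == 1)%R = s)%N.
Proof.
have := card_circle_fiber (oner_neq0 K); rewrite !expr1n => h; exact: (h erefl).
Qed.

Lemma sum_circle_const c : (\sum_(b : K | U b) c = q.+1 * c)%N.
Proof.
rewrite sum_nat_const -[in RHS](card_circle p_prime e_gt0 q_def card_K).
by congr (_ * _)%N; apply: eq_card.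
Qed.

Lemma nb_points_fermat :
  nb_rational_points (fermat K m) = (1 + q ^ 2 + 2 * q * 'C(m.-1, 2))%N.
Proof.
rewrite (nb_rational_points_affine (fermat_homog K m)).
rewrite fermat_vec expr1n expr0n gtn_eqF ?m_gt0// !addr0 oner_eq0 addn0.
have -> : (\sum_(x : K) (eval_at (fermat K m) (vec3 x 1 0) == 0)%R = m)%N.
  rewrite (sum_pred_card (fun x : K => eval_at (fermat K m) (vec3 x 1 0) == 0)).
  rewrite -[RHS]card_mth_rootsN1; apply: eq_card => x; rewrite !inE fermat_vec.
  by rewrite expr1n expr0n gtn_eqF ?m_gt0// addr0 addr_eq0.
pose r (a : K) := #|[pred x : K | x ^+ m == a]|.
have -> : (\sum_(x : K) \sum_y (eval_at (fermat K m) (vec3 x y 1) == 0)%R =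
           \sum_a r a * r (-1 - a)%R)%N.
  rewrite -(sum_over_fibers (fun x => x ^+ m) (fun a => r (-1 - a))).
  apply: eq_bigr => x _.
  rewrite (sum_pred_card (fun y : K => eval_at (fermat K m) (vec3 x y 1) == 0)).
  apply: eq_card => y; rewrite !inE fermat_vec expr1n -[RHS]subr_eq0.
  by congr (_ == 0); ring.
have N10 : (-1 : K) != 0 by rewrite oppr_eq0 oner_eq0.
(* The terms a = 0 and a = -1, where one affine coordinate vanishes, contribute [m] points each, as
   does the line at infinity. *)
rewrite (bigD1 0)//= (bigD1 (-1))//= subr0 subrr /r card_mth_roots0 card_mth_rootsN1.
pose Q (a b : K) : nat := (m ^ 2 * ((a ^+ s == 1)%R * (b ^+ s == 1)%R))%N.
rewrite (eq_bigr (fun a => Q (phase a) (phase (-1 - a)))); last first.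
  move=> a /andP[a0 a1]; have b0 : -1 - a != 0 by rewrite subr_eq0 eq_sym.
  rewrite !card_mth_roots// /Q.
  by rewrite mulnACA mulnn.
have := phase_sum p_prime e_gt0 q_def card_K Q.
set S := (\sum_(a | (a != 0%R) && (a != -1)%R) _)%N.
have m2s : (\sum_(b | U b) m ^ 2 * (b ^+ s == 1)%R = m ^ 2 * s)%N.
  by rewrite -big_distrr /= card_circle_roots.
have -> : (\sum_(b | U b) Q 1%R b = m ^ 2 * s)%N.
  by rewrite -m2s; apply: eq_bigr => b _; rewrite /Q expr1n eqxx /= mul1n.
have -> : (\sum_(a | U a) Q a 1%R = m ^ 2 * s)%N.
  by rewrite -m2s; apply: eq_bigr => b _; rewrite /Q expr1n eqxx /= muln1.
have -> : (\sum_(a | U a) Q a a = m ^ 2 * s)%N.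
  by rewrite -m2s; apply: eq_bigr => b _; rewrite /Q mulnb andbb.
have -> : (\sum_(a | U a) \sum_(b | U b) Q a b = m ^ 2 * s * s)%N.
  rewrite -m2s big_distrl /=; apply: eq_bigr => a _.
  by rewrite -big_distrr -big_distrr /= card_circle_roots mulnA.
have -> : Q 1 1 = (m ^ 2)%N by rewrite /Q !expr1n eqxx /= !muln1.
have -> : (m ^ 2 * s * s = q.+1 ^ 2)%N by rewrite -ms expnMn -mulnA mulnn.
have -> : (m ^ 2 * s = m * q.+1)%N by rewrite -ms mulnA mulnn.
(* The total is S + 3 m, where S + 3 m (q + 1) = (q + 1)^2 + q m^2, that is, 1 + q^2 + q (m - 1)(m -
   2). *)
have := mul_bin_diag m.-1 1; rewrite bin1.
have -> : (2 * q * 'C(m.-1, 2) = q * (2 * 'C(m.-1, 2)))%N by rewrite mulnCA mulnA.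
move=> <-; move: S => {}S; rewrite mul1n muln1.
have := m_gt0; case: m => [//|[|k]] _ /=; nia.
Qed.

Variable n : nat.
Hypotheses (n_gt0 : (0 < n)%N) (m_def : m = (n ^ 2 - n + 1)%N).

Lemma m_sq : (m + n = n * n + 1)%N.
Proof. rewrite m_def; nia. Qed.

(** Modulo [m] the product n (n - 1) is -1, so [n] is invertible and the [n]-th power is injective
    on [m]-th roots of unity. *)
Lemma root_exp_n (c : K) : c ^+ m = 1 -> (c ^+ n == 1) = (c == 1).
Proof.
move=> cm; apply/eqP/eqP => [cn|->]; last by rewrite expr1n.
have := congr1 (fun k => c ^+ k) m_sq.
by rewrite !exprD expr1 exprM cn expr1n cm !mul1r.
Qed.

(** Likewise n - 1 is invertible modulo [m]. *)
Lemma root_exp_fix (c : K) : c ^+ m = 1 -> (c == c ^+ n) = (c == 1).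
Proof.
move=> cm; apply/eqP/eqP => [cn|->]; last by rewrite expr1n.
have c0 : c != 0.
  by apply/eqP => c0; move/eqP: cm; rewrite c0 expr0n gtn_eqF ?m_gt0// eq_sym oner_eq0.
have := congr1 (fun k => c ^+ k) m_sq.
rewrite !exprD expr1 exprM -!cn cm mul1r => h.
by apply: (mulfI c0); rewrite mulr1 [RHS]h.
Qed.

(** In the coordinate a = x^(n-1) y the equation reads x a + y^n + x = 0. Since m = n (n - 1) + 1,
    one has y^n x^m = x a^n, so multiplying by x^m and dividing by x gives x^m (-1 - a) = a^n. *)
Lemma hurwitz_torus (x a : K) : x != 0 -> a != 0 ->
  let y := x^-1 ^+ n.-1 * a in
  (x ^+ n * y + y ^+ n * 1 + 1 ^+ n * x == 0) = (a != -1) && (x ^+ m == a ^+ n / (-1 - a)).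
Proof.
move=> x0 a0 y; rewrite expr1n mulr1 mul1r.
have y1 : x ^+ n * y = x * a.
  by rewrite /y exprVn mulrA -{1}(prednK n_gt0) exprS mulfK// expf_neq0.
have y2 : y ^+ n * x ^+ m = x * a ^+ n.
  rewrite /y exprMn exprVn -exprVn mulrAC -exprM exprVn; congr (_ * _).
  have xk : x ^+ (n.-1 * n) != 0 by rewrite expf_neq0.
  apply: (mulfI xk); rewrite mulrA divff// mul1r -exprSr; congr (_ ^+ _).
  rewrite m_def; move: n_gt0; case: n => // k _; rewrite /=; nia.
have xm0 : x ^+ m != 0 by rewrite expf_neq0.
rewrite y1; have -> : (x * a + y ^+ n + x == 0) = (x ^+ m * (-1 - a) == a ^+ n).
  rewrite -[LHS](inj_eq (mulIf xm0)) mul0r !mulrDl y2 -[RHS](inj_eq (mulfI x0)).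
  by rewrite -[RHS]subr_eq0 -[RHS]oppr_eq0; congr (_ == 0); ring.
have [->|a1] := eqVneq a (-1).
  by rewrite subrr mulr0 eq_sym expf_eq0 oppr_eq0 oner_eq0 andbF.
have b0 : -1 - a != 0 by rewrite subr_eq0 eq_sym.
by rewrite /= -[RHS](inj_eq (mulIf b0)) divfK.
Qed.

Lemma nb_points_hurwitz :
  nb_rational_points (hurwitz K n) = (1 + q ^ 2 + 2 * q * 'C(n, 2))%N.
Proof.
rewrite (nb_rational_points_affine (hurwitz_homog K n)).
rewrite hurwitz_vec !expr0n !gtn_eqF// !(mul0r, mulr0, addr0) eqxx.
have -> : (\sum_(x : K) (eval_at (hurwitz K n) (vec3 x 1 0) == 0)%R = 1)%N.
  rewrite (sum_pred_card (fun x : K => eval_at (hurwitz K n) (vec3 x 1 0) == 0)).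
  rewrite -(card1 (0 : K)); apply: eq_card => x; rewrite !inE hurwitz_vec.
  by rewrite expr0n gtn_eqF// mul0r mulr0 mulr1 !addr0 expf_eq0 n_gt0.
pose h (x y : K) : nat := x ^+ n * y + y ^+ n * 1 + 1 ^+ n * x == 0.
have -> : (\sum_(x : K) \sum_y (eval_at (hurwitz K n) (vec3 x y 1) == 0)%R =
           \sum_x \sum_y h x y)%N.
  by apply: eq_bigr => x _; apply: eq_bigr => y _; rewrite hurwitz_vec.
(* For phases a of A and b of -1 - A, this is the number of solutions of x^m = A^n / (-1 - A). *)
pose Q (a b : K) : nat := (m * (a ^+ n ^+ s == b ^+ s)%R)%N.
have -> : (\sum_x \sum_y h x y =
  1 + \sum_(a : K | ((a != 0) && (a != -1))%R) Q (phase a) (phase (-1 - a)%R))%N.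
  rewrite (bigD1 0)//=; congr (_ + _)%N.
    rewrite (sum_pred_card (fun y : K => 0 ^+ n * y + y ^+ n * 1 + 1 ^+ n * 0 == 0)).
    rewrite -(card1 (0 : K)); apply: eq_card => y; rewrite !inE.
    by rewrite expr0n gtn_eqF// mul0r mulr0 mulr1 add0r addr0 expf_eq0 n_gt0.
  (* For x nonzero, y = 0 is not a solution, and the remaining y are replaced by a = x^(n-1) y. *)
  transitivity (\sum_(x : K | x != 0%R) \sum_(a : K | a != 0%R)
      ((a != -1) && (x ^+ m == a ^+ n / (-1 - a)))%R)%N.
    apply: eq_bigr => x x0; rewrite (bigD1 0)//=.
    rewrite {1}/h mulr0 expr0n gtn_eqF// mul0r !add0r {1}expr1n mul1r (negbTE x0) add0n.
    have z0 : x^-1 ^+ n.-1 != 0 by rewrite expf_neq0 ?invr_eq0.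
    rewrite (reindex_inj (mulfI z0)) /=; apply: eq_big => a.
      by rewrite mulf_eq0 (negbTE z0).
    by rewrite mulf_eq0 (negbTE z0) /= => a0; rewrite /h hurwitz_torus.
  rewrite exchange_big /= [RHS]big_mkcondr /=; apply: eq_bigr => a a0.
  have [->|a1] := eqVneq a (-1); first by rewrite big1.
  have b0 : -1 - a != 0 by rewrite subr_eq0 eq_sym.
  have c0 : a ^+ n / (-1 - a) != 0 by rewrite mulf_neq0 ?invr_eq0 ?expf_neq0.
  transitivity #|[pred x : K | x ^+ m == a ^+ n / (-1 - a)]|.
    rewrite -(sum_pred_card (fun x : K => x ^+ m == a ^+ n / (-1 - a))) [RHS](bigD1 0)//=.
    by rewrite expr0n gtn_eqF ?m_gt0// eq_sym (negbTE c0).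
  rewrite card_mth_roots// /Q; congr (_ * (_ : bool))%N.
  have bs0 : phase (-1 - a) ^+ s != 0 by rewrite !expf_neq0.
  rewrite -[LHS](inj_eq (mulIf bs0)) mul1r; congr (_ == _).
  rewrite /phase expr_div_n -[a ^+ n ^+ _]exprM mulnC exprM expr_div_n divfK//.
have := phase_sum p_prime e_gt0 q_def card_K Q.
set S := (\sum_(a | (a != 0%R) && (a != -1)%R) _)%N.
(* As a^s is an [m]-th root of unity, the conditions on the lines b = 1 and a = b both reduce to a^s
   = 1, as on the line a = 1 they do to b^s = 1; each line contributes m s = q + 1. *)
have Um a : U a -> a ^+ s ^+ m = 1.
  by rewrite /unit_circle /= -ms mulnC exprM => /eqP.
have ms1 : (\sum_(b | U b) m * (b ^+ s == 1)%R = m * s)%N.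
  by rewrite -big_distrr /= card_circle_roots.
have -> : (\sum_(b | U b) Q 1%R b = m * s)%N.
  by rewrite -ms1; apply: eq_bigr => b _; rewrite /Q !expr1n eq_sym.
have -> : (\sum_(a | U a) Q a 1%R = m * s)%N.
  rewrite -ms1; apply: eq_bigr => a Ua; rewrite /Q expr1n; congr (_ * (_ : bool))%N.
  by rewrite -exprM mulnC exprM root_exp_n// Um.
have -> : (\sum_(a | U a) Q a a = m * s)%N.
  rewrite -ms1; apply: eq_bigr => a Ua; rewrite /Q; congr (_ * (_ : bool))%N.
  by rewrite -exprM mulnC exprM eq_sym root_exp_fix// Um.
have -> : (\sum_(a | U a) \sum_(b | U b) Q a b = q.+1 * (m * s))%N.
  rewrite -sum_circle_const; apply: eq_bigr => a Ua.
  rewrite -big_distrr /=; congr (_ * _)%N; have [a0 _] := circle_inv Ua.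
  rewrite -[RHS](@card_circle_fiber (a ^+ n)) ?expf_neq0//.
    by apply: eq_bigr => b _; rewrite eq_sym.
  by rewrite -exprM -exprM [(n * _)%N]mulnC exprM exprM Um ?expr1n.
have -> : Q 1 1 = m by rewrite /Q !expr1n eqxx /= muln1.
move: S => {}S; rewrite ms.
(* The three coordinate points bring the total to S + 3, where S + 3 (q + 1) = (q + 1)^2 + q m, that
   is, 1 + q^2 + q n (n - 1). *)
have := mul_bin_diag n 1; rewrite bin1.
have -> : (2 * q * 'C(n, 2) = q * (2 * 'C(n, 2)))%N by rewrite mulnCA mulnA.
move=> <-; have := m_sq; move: n_gt0; case: n => // k _ /=; nia.
Qed.
End Counting.

(** * Covering by the Hermitian curve and maximality *)

Theorem corollary3p3
    (p e q n : nat) (K : finFieldType) (Kbar : closedFieldType)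
    (iota : {rmorphism K -> Kbar})
    (p_prime : prime p) (e_gt0 : (0 < e)%N) (q_def : q = (p ^ e)%N)
    (card_K : #|K| = (q ^ 2)%N) (Kbar_algebraic : integralRange iota)
    (n_gt0 : (0 < n)%N) (p_ndvd : ~~ (p %| n ^ 2 - n + 1)%N)
    (q_mod : (q + 1 = 0 %[mod n ^ 2 - n + 1])%N) :
  [/\ covered_by iota (hurwitz K n) (hermitian K q),
      covered_by iota (fermat K (n ^ 2 - n + 1)) (hermitian K q),
      maximal q iota (hurwitz K n) &
      maximal q iota (fermat K (n ^ 2 - n + 1))].
Proof.
set m := (n ^ 2 - n + 1)%N in p_ndvd q_mod *.
have m_gt0 : (0 < m)%N by rewrite /m addn1.
(* The field has characteristic [p], so [p_ndvd] makes [m] invertible; this gives the nonsingularity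
   of both curves. *)
have m0 : m%:R != 0 :> Kbar.
  rewrite -(rmorph_nat iota) fmorph_eq0.
  by rewrite -(dvdn_pcharf (pchar_K p_prime q_def card_K)).
have [s ms] : exists s, (m * s)%N = q.+1.
  have /dvdnP[s sm] : (m %| q + 1)%N by rewrite /dvdn q_mod mod0n.
  by exists s; rewrite mulnC -sm addn1.
have s_gt0 : (0 < s)%N by case: s ms => //; rewrite muln0.
have nonzero (F : {mpoly K[3]}) : irreducible_form (base_change iota F) -> F != 0.
  by move=> [F0 _ _]; apply: contraNneq F0 => ->; rewrite /base_change rmorph0.
have irrH : geometrically_irreducible iota (hurwitz K n).
  by rewrite /geometrically_irreducible base_change_hurwitz; exact: hurwitz_irreducible.
have irrF : geometrically_irreducible iota (fermat K m).
  by rewrite /geometrically_irreducible base_change_fermat; exact: fermat_irreducible.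
split.
- by rewrite /hermitian -ms; exact: hurwitz_covered.
- by rewrite /hermitian -ms; exact: fermat_covered.
- split=> //.
  + by exists n.+1; exact: hurwitz_homog.
  + by apply: nonsingular_base_change; rewrite base_change_hurwitz; exact: hurwitz_nonsingular.
  + exists 'C(n, 2).
      exact: has_genus_plane (ltn0Sn n) (hurwitz_homog K n) (nonzero _ irrH).
    exact: (nb_points_hurwitz p_prime e_gt0 q_def card_K ms n_gt0 (erefl m)).
- split=> //.
  + by exists m; exact: fermat_homog.
  + by apply: nonsingular_base_change; rewrite base_change_fermat; exact: fermat_nonsingular.
  + exists 'C(m.-1, 2).
      exact: has_genus_plane m_gt0 (fermat_homog K m) (nonzero _ irrF).
    exact: (nb_points_fermat p_prime e_gt0 q_def card_K ms).
Qed.
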